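(* Let $\Delta_T\to0$ as $T\to\infty$. Then for every $\vartheta\in\Theta$ the family $(\mathcal E^{T,\Delta_T})_{T>0}$ satisfies the LAN property at $\vartheta$ with normalisation $I_{T,0}(\vartheta)=T/\vartheta$. Moreover $I_{T,0}(\vartheta)=\lim_{\Delta\to0}T\Delta\,\varphi(\vartheta,\Delta)$.
   Context: Model: $\Theta\subseteq(0,\infty)$ is an open parameter set. Under $\mathbb P_\vartheta$, $X_t=\sum_{i=1}^{N_t}\varepsilon_i$ ($X_0=0$), where $(N_t)$ is a homogeneous Poisson process of intensity $\vartheta$ and the $\varepsilon_i$ are i.i.d., independent of $(N_t)$, with $\mathbb P(\varepsilon_i=1)=\mathbb P(\varepsilon_i=-1)=1/2$. For $T>0$ and $0<\Delta\le T$, the experiment $\mathcal E^{T,\Delta}=\{\mathbb P^{T,\Delta}_\vartheta,\vartheta\in\Theta\}$ consists of the law of $(X_0,X_\Delta,\dots,X_{\lfloor T/\Delta\rfloor\Delta})$. The increment law is $f_\Delta(\vartheta,k)=e^{-\vartheta\Delta}\mathcal I_{|k|}(\vartheta\Delta)$, $k\in\mathbb Z$, with $\mathcal I_\nu(x)=\sum_{m\ge0}\frac{(x/2)^{2m+\nu}}{m!\,\Gamma(\nu+m+1)}$. Set $h_\Delta(\vartheta,k)=\mathcal I_{|k|+1}(\vartheta\Delta)/\mathcal I_{|k|}(\vartheta\Delta)$ and $\varphi(\vartheta,\Delta)=\mathbb E_\vartheta\big[\big(h_\Delta(\vartheta,X_\Delta)+(\vartheta\Delta)^{-1}|X_\Delta|-1\big)^2\big]$.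 LAN: the family satisfies LAN at $\vartheta$ with normalisation $I_T(\vartheta)>0$ if for every $v$ with $\vartheta+vI_T(\vartheta)^{-1/2}\in\Theta$, $\frac{d\mathbb P^{T,\Delta_T}_{\vartheta+vI_T(\vartheta)^{-1/2}}}{d\mathbb P^{T,\Delta_T}_\vartheta}=\exp(v\xi_T-\tfrac12v^2+r_T)$ with $\xi_T\to\mathcal N(0,1)$ in distribution and $r_T\to0$ in probability under $\mathbb P^{T,\Delta_T}_\vartheta$. *)

(* Defs.v *)
From Stdlib Require Import Reals Lra ZArith List ClassicalEpsilon.
Open Scope R_scope.

(* limit of a real sequence (chosen by Hilbert epsilon; meaningful when it converges) *)
Definition lim_seq (u : nat -> R) : R :=
  epsilon (inhabits 0) (fun l => Un_cv u l).

Definition zsum (g : Z -> R) : R :=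
  lim_seq (fun K => sum_f_R0 (fun j => g (Z.of_nat j - Z.of_nat K)%Z) (2 * K)).

Fixpoint boxsum (n K : nat) (g : list Z -> R) : R :=
  match n with
  | O => g nil
  | S n' => sum_f_R0
      (fun j => boxsum n' K (fun l => g ((Z.of_nat j - Z.of_nat K)%Z :: l))) (2 * K)
  end.

Definition prodlist (p : Z -> R) (l : list Z) : R :=
  fold_right (fun z acc => p z * acc) 1 l.

Definition indic (P : Prop) : R :=
  if excluded_middle_informative P then 1 else 0.

Definition prob_iid (p : Z -> R) (n : nat) (A : list Z -> Prop) : R :=
  lim_seq (fun K => boxsum n K (fun l => prodlist p l * indic (A l))).

(* I_nu(x) = sum_m (x/2)^(2m+nu) / (m! Gamma(nu+m+1)),  Gamma(nu+m+1) = (nu+m)! *)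
Definition besselI (nu : nat) (x : R) : R :=
  lim_seq (fun M => sum_f_R0
    (fun m => (x / 2) ^ (2 * m + nu) / (INR (fact m) * INR (fact (nu + m)))) M).

(* increment law f_Delta(theta, k) = e^{-theta Delta} I_{|k|}(theta Delta) *)
Definition fD (Delta th : R) (k : Z) : R :=
  exp (- (th * Delta)) * besselI (Z.abs_nat k) (th * Delta).

Definition hD (Delta th : R) (k : Z) : R :=
  besselI (S (Z.abs_nat k)) (th * Delta) / besselI (Z.abs_nat k) (th * Delta).

Definition phiD (th Delta : R) : R :=
  zsum (fun k => fD Delta th k *
                 (hD Delta th k + IZR (Z.abs k) / (th * Delta) - 1) ^ 2).

Definition nobs (T Delta : R) : nat := Z.to_nat (Int_part (T / Delta)).

(* observation (X_0, X_Delta, ..., X_{n Delta}) built from the increments *)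
Fixpoint psums (s : Z) (y : list Z) : list Z :=
  match y with
  | nil => nil
  | z :: y' => (s + z)%Z :: psums (s + z)%Z y'
  end.
Definition path_of (y : list Z) : list Z := 0%Z :: psums 0%Z y.

(* density of P_{theta'} w.r.t. P_theta at an observed path x = (x_0,...,x_n):
   prod_i p(x_i - x_{i-1}) / q(x_i - x_{i-1}) *)
Fixpoint lr_path (p q : Z -> R) (x : list Z) : R :=
  match x with
  | a :: ((b :: _) as x') => p (b - a)%Z / q (b - a)%Z * lr_path p q x'
  | _ => 1
  end.

Definition prob_obs (th Delta T : R) (A : list Z -> Prop) : R :=
  prob_iid (fD Delta th) (nobs T Delta) (fun y => A (path_of y)).

Definition gauss (t : R) : R := exp (- (t * t) / 2).

Lemma gauss_cont : forall x, continuity_pt gauss x.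
Proof. intro x; unfold gauss; apply derivable_continuous_pt; reg. Qed.

Definition gauss_int (a b : R) (H : a <= b) : Riemann_integrable gauss a b :=
  @continuity_implies_RiemannInt gauss a b H (fun x _ => gauss_cont x).

(* Phi(x) = 1/2 + (1/sqrt(2 pi)) * int_0^x e^{-t^2/2} dt  (oriented integral) *)
Definition Phi (x : R) : R :=
  match Rle_dec 0 x with
  | left H => / 2 + / sqrt (2 * PI) * RiemannInt (gauss_int 0 x H)
  | right H => / 2 - / sqrt (2 * PI) * RiemannInt (gauss_int x 0 (Rlt_le _ _ (Rnot_le_lt _ _ H)))
  end.

(* LAN of (E^{T,Delta_T})_{T>0} at th with normalisation I_T:
   there are statistics xi_T (functions of the observation) with xi_T => N(0,1)
   under P_th, and for every v the remainder
   r_T = log(dP_{th + v I_T^{-1/2}}/dP_th) - (v xi_T - v^2/2)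
   tends to 0 in P_th-probability (for T with th + v I_T^{-1/2} in Theta). *)
Definition LAN (Theta : R -> Prop) (Delta : R -> R) (th : R) (I : R -> R) : Prop :=
  (forall T, 0 < T -> 0 < I T) /\
  exists xi : R -> list Z -> R,
    (forall x eps, 0 < eps -> exists T0, forall T, T0 <= T -> 0 < T ->
       Rabs (prob_obs th (Delta T) T (fun obs => xi T obs <= x) - Phi x) < eps) /\
    (forall v eps del, 0 < eps -> 0 < del -> exists T0, forall T, T0 <= T -> 0 < T ->
       Theta (th + v / sqrt (I T)) ->
       prob_obs th (Delta T) T
         (fun obs => eps < Rabs (ln (lr_path (fD (Delta T) (th + v / sqrt (I T)))
                                             (fD (Delta T) th) obs)
                                 - (v * xi T obs - v ^ 2 / 2))) < del).

(* Main.v *)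
Require Import Defs.
From Stdlib Require Import Reals Lra Lia ZArith List ClassicalEpsilon.
From Coquelicot Require Import Coquelicot.
Open Scope R_scope.

(** The log-likelihood ratio of one increment k is, writing lam = th * D and
    th' = th (1 + r) with r = v / sqrt (th T),
      - lam r + |k| ln (1 + r) + lam r h(k) + O(lam^2 r^2),
    uniformly in k, because I_nu(x) = (x/2)^nu J_nu(x/2) with J_nu an even power
    series whose second order Taylor remainder is O(J_nu). The Bessel recurrence
    k I_k = (x/2) (I_(k-1) - I_(k+1)) and summation by parts give E k^2 = lam,
    E k^4 = 3 lam^2 + lam and E (|k| + lam h - lam) = 0. Hence
    xi_T = sum (|k| - E|k|) / sqrt (th T) is a central sequence: the sum of the
    remainders tends to 0 in probability by Chebyshev's inequality. Its asymptotic
    normality is Lindeberg's replacement argument applied to the explicit solution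
    u(s, y) = Phi (y / sqrt s) of the heat equation, so that no Gaussian random
    variables are needed. All expectations are limits over the boxes [-K, K]^n. *)

(** * Symmetric sums over the integers *)

(** The obstacle is that several first order terms of the log-likelihood are not negligible. With n
    observations, the terms [lam r h(k)] and [r (E|k| - lam)] sum to order [n lam^2 r], that is
    [lam v sqrt (th T)], and this need not be small when [Delta] tends to 0 slowly. They are
    therefore never estimated: the zero mean of the score gives [E h = 1 - E|k| / lam] exactly, and
    with the centring at the exact [E|k|] all terms linear in r cancel in the mean. What is left
    needs only [lam - lam^2 <= E|k| <= lam], so no closed form of [E|k|] is required. The heat
    solution u is singular at s = 0. The replacement starts at a smoothing variance eta > 0, fixed
    before T grows, and its constants depend on eta alone. All bounds are non-asymptotic, of the
    form constant times [th D + 1 / sqrt (th T)]; limits in T are taken only at the very end. *)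

Lemma lim_seq_eq (u : nat -> R) (l : R) : Un_cv u l -> lim_seq u = l.
Proof.
  intros H. apply (UL_sequence u); [|exact H].
  unfold lim_seq. apply epsilon_spec. now exists l.
Qed.

Lemma Un_cv_const (c : R) : Un_cv (fun _ => c) c.
Proof.
  intros e He. exists 0%nat. intros n _. unfold Rdist.
  now rewrite Rminus_diag, Rabs_R0.
Qed.

Lemma Un_cv_ext (u v : nat -> R) (l : R) :
  (forall n, u n = v n) -> Un_cv u l -> Un_cv v l.
Proof.
  intros E H e He. destruct (H e He) as [N HN]. exists N.
  intros n Hn. rewrite <- E. now apply HN.
Qed.

Lemma Un_cv_squeeze0 (u v : nat -> R) :
  (forall n, Rabs (u n) <= v n) -> Un_cv v 0 -> Un_cv u 0.
Proof.
  intros E H e He. destruct (H e He) as [N HN]. exists N.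
  intros n Hn. specialize (HN n Hn). specialize (E n).
  unfold Rdist in *. rewrite Rminus_0_r in *. revert HN. unfold Rabs.
  unfold Rabs in E. destruct (Rcase_abs (u n)), (Rcase_abs (v n)); lra.
Qed.

Lemma Un_cv_S (u : nat -> R) (l : R) : Un_cv u l -> Un_cv (fun n => u (S n)) l.
Proof.
  intros H e He. destruct (H e He) as [N HN]. exists N.
  intros n Hn. apply HN. lia.
Qed.

Lemma growing_bounded_cv (u : nat -> R) (M : R) :
  (forall n, u n <= u (S n)) -> (forall n, u n <= M) ->
  exists l, Un_cv u l /\ (forall n, u n <= l) /\ l <= M.
Proof.
  intros H1 H2.
  destruct (growing_cv u H1) as [l Hl].
  { exists M. intros x [i ->]. apply H2. }
  exists l. split; [exact Hl|]. split.
  - intros n. now apply (growing_ineq u).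
  - apply (@Rle_cv_lim u (fun _ => M) l M); [exact H2|exact Hl|apply Un_cv_const].
Qed.

(** The partial sum inside [zsum] and one level of [boxsum], so that both unfold to it by
    conversion. *)
Definition sym_sum (K : nat) (F : Z -> R) : R :=
  sum_f_R0 (fun j => F (Z.of_nat j - Z.of_nat K)%Z) (2 * K).

Lemma sym_sum_0 (F : Z -> R) : sym_sum 0 F = F 0%Z.
Proof. reflexivity. Qed.

Lemma sym_sum_S (K : nat) (F : Z -> R) :
  sym_sum (S K) F = sym_sum K F + F (Z.of_nat (S K)) + F (- Z.of_nat (S K))%Z.
Proof.
  unfold sym_sum. replace (2 * S K)%nat with (S (S (2 * K))) by lia.
  rewrite tech5, decomp_sum by lia. cbn [Nat.pred].
  rewrite (sum_eq (fun i => F (Z.of_nat (S i) - Z.of_nat (S K))%Z)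
             (fun j => F (Z.of_nat j - Z.of_nat K)%Z)).
  2: { intros i _. f_equal. lia. }
  replace (Z.of_nat (S (S (2 * K))) - Z.of_nat (S K))%Z with (Z.of_nat (S K)) by lia.
  replace (Z.of_nat 0 - Z.of_nat (S K))%Z with (- Z.of_nat (S K))%Z by lia.
  ring.
Qed.

Lemma sym_sum_ext (K : nat) (F G : Z -> R) :
  (forall z, (Z.abs z <= Z.of_nat K)%Z -> F z = G z) -> sym_sum K F = sym_sum K G.
Proof. intros H. apply sum_eq. intros; apply H; lia. Qed.

Lemma sym_sum_plus (K : nat) (F G : Z -> R) :
  sym_sum K (fun z => F z + G z) = sym_sum K F + sym_sum K G.
Proof. apply sum_plus. Qed.

Lemma sym_sum_scal (K : nat) (c : R) (F : Z -> R) :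
  sym_sum K (fun z => c * F z) = c * sym_sum K F.
Proof.
  unfold sym_sum. rewrite scal_sum. apply sum_eq. intros; ring.
Qed.

Lemma sym_sum_le (K : nat) (F G : Z -> R) :
  (forall z, (Z.abs z <= Z.of_nat K)%Z -> F z <= G z) -> sym_sum K F <= sym_sum K G.
Proof. intros H. apply sum_Rle. intros; apply H; lia. Qed.

Lemma sym_sum_abs (K : nat) (F : Z -> R) :
  Rabs (sym_sum K F) <= sym_sum K (fun z => Rabs (F z)).
Proof. apply Rsum_abs. Qed.

Lemma sym_sum_nonneg (K : nat) (F : Z -> R) :
  (forall z, 0 <= F z) -> 0 <= sym_sum K F.
Proof. intros H. apply cond_pos_sum. intros; apply H. Qed.

Lemma sym_sum_growing (K : nat) (F : Z -> R) :
  (forall z, 0 <= F z) -> sym_sum K F <= sym_sum (S K) F.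
Proof.
  intros H. rewrite sym_sum_S.
  pose proof (H (Z.of_nat (S K))). pose proof (H (- Z.of_nat (S K))%Z). lra.
Qed.

Lemma sym_sum_telescope (K : nat) (F : Z -> R) :
  sym_sum K (fun z => F (z + 1)%Z - F z) =
  F (Z.of_nat (S K)) - F (- Z.of_nat K)%Z.
Proof.
  induction K as [|K IH]; [reflexivity|].
  rewrite sym_sum_S, IH.
  replace (Z.of_nat (S K) + 1)%Z with (Z.of_nat (S (S K))) by lia.
  replace (- Z.of_nat (S K) + 1)%Z with (- Z.of_nat K)%Z by lia.
  ring.
Qed.

(** Two telescoping sums, of [c k * u (k - 1)] and of [c (k - 1) * u k], move both shifts from u
    onto c. The four boundary products stay explicit, to be bounded later by the decay of the Bessel
    functions. *)
Lemma sym_sum_by_parts (K : nat) (c u : Z -> R) :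
  sym_sum K (fun k => c k * (u (k - 1)%Z - u (k + 1)%Z)) =
  sym_sum K (fun k => (c (k + 1)%Z - c (k - 1)%Z) * u k)
  - (c (Z.of_nat (S K)) * u (Z.of_nat K) - c (- Z.of_nat K)%Z * u (- Z.of_nat (S K))%Z)
  - (c (Z.of_nat K) * u (Z.of_nat (S K)) - c (- Z.of_nat (S K))%Z * u (- Z.of_nat K)%Z).
Proof.
  pose proof (sym_sum_telescope K (fun k => c k * u (k - 1)%Z)) as HU.
  pose proof (sym_sum_telescope K (fun k => c (k - 1)%Z * u k)) as HV.
  cbv beta in HU, HV.
  replace (Z.of_nat (S K) - 1)%Z with (Z.of_nat K) in HU, HV by lia.
  replace (- Z.of_nat K - 1)%Z with (- Z.of_nat (S K))%Z in HU, HV by lia.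
  rewrite <- HU, <- HV.
  rewrite (sym_sum_ext K (fun k => c k * (u (k - 1)%Z - u (k + 1)%Z))
    (fun k => (c (k + 1)%Z - c (k - 1)%Z) * u k +
       (-1) * ((c (k + 1)%Z * u (k + 1 - 1)%Z - c k * u (k - 1)%Z) +
               (c (k + 1 - 1)%Z * u (k + 1)%Z - c (k - 1)%Z * u k)))).
  - rewrite sym_sum_plus, sym_sum_scal, sym_sum_plus. ring.
  - intros z _. replace (z + 1 - 1)%Z with z by lia. ring.
Qed.

(** * Modified Bessel functions *)

Lemma is_series_scal_R (c : R) (a : nat -> R) (l : R) :
  is_series a l -> is_series (fun n => c * a n) (c * l).
Proof. exact (is_series_scal_l c a l). Qed.

Lemma is_series_minus_R (a b : nat -> R) (la lb : R) :
  is_series a la -> is_series b lb -> is_series (fun n => a n - b n) (la - lb).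
Proof. exact (is_series_minus a b la lb). Qed.

Lemma is_series_ext_R (a b : nat -> R) (l : R) :
  (forall n, a n = b n) -> is_series a l -> is_series b l.
Proof. exact (is_series_ext a b l). Qed.

Lemma sum_rev (b : nat -> R) (N : nat) :
  sum_f_R0 (fun k => b (N - k)%nat) N = sum_f_R0 b N.
Proof.
  induction N as [|N IH]; [reflexivity|].
  rewrite decomp_sum by lia. simpl pred. rewrite (tech5 b), <- IH.
  rewrite Nat.sub_0_r, (Rplus_comm (b (S N))). f_equal.
Qed.

Lemma abs_nat_opp_of_nat (n : nat) : Z.abs_nat (- Z.of_nat n) = n.
Proof. lia. Qed.

Lemma sym_sum_even (b : nat -> R) (N : nat) :
  sym_sum N (fun k => b (Z.abs_nat k)) = 2 * sum_f_R0 b N - b 0%nat.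
Proof.
  induction N as [|N IH].
  - rewrite sym_sum_0. simpl. lra.
  - rewrite sym_sum_S, IH, tech5, abs_nat_opp_of_nat, Zabs2Nat.id. ring.
Qed.

Definition exp_term (y : R) (i : nat) : R := y ^ i / INR (fact i).

Lemma exp_term_nonneg (y : R) (i : nat) : 0 <= y -> 0 <= exp_term y i.
Proof.
  intros H. apply Rmult_le_pos; [now apply pow_le|].
  apply Rlt_le, Rinv_0_lt_compat, INR_fact_lt_0.
Qed.

Lemma exp_term_cv (y : R) : Un_cv (sum_f_R0 (exp_term y)) (exp y).
Proof.
  unfold exp. destruct (exist_exp y) as [l Hl]. simpl.
  intros e He. destruct (Hl e He) as [N HN]. exists N. intros n Hn.
  specialize (HN n Hn).
  rewrite (sum_eq (exp_term y) (fun i => / INR (fact i) * y ^ i)); [exact HN|].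
  intros i _. unfold exp_term, Rdiv. ring.
Qed.

Lemma exp_term_series (y : R) : is_series (exp_term y) (exp y).
Proof. apply is_series_Reals. exact (exp_term_cv y). Qed.

(* Grouping the square [0, N]^2 by the difference of the coordinates. *)
Lemma exp_square (y : R) (N : nat) :
  sym_sum N (fun k => sum_f_R0 (fun m => exp_term y m * exp_term y (m + Z.abs_nat k))
                        (N - Z.abs_nat k))
  = (sum_f_R0 (exp_term y) N) ^ 2.
Proof.
  set (a := exp_term y).
  induction N as [|N IH].
  - rewrite sym_sum_0. simpl. ring.
  - rewrite sym_sum_S, abs_nat_opp_of_nat, Zabs2Nat.id, Nat.sub_diag.
    (* Enlarging the square adds exactly one point to each diagonal with |k| <= N, the one whose
       larger coordinate is N + 1. *)
    rewrite (sym_sum_ext N _ (fun k =>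
      sum_f_R0 (fun m => a m * a (m + Z.abs_nat k)%nat) (N - Z.abs_nat k)
      + a (S N) * (fun i => a (S N - i)%nat) (Z.abs_nat k))).
    2: { intros z Hz. replace (S N - Z.abs_nat z)%nat with (S (N - Z.abs_nat z)) by lia.
         rewrite tech5. f_equal.
         replace (S (N - Z.abs_nat z) + Z.abs_nat z)%nat with (S N) by lia. ring. }
    rewrite sym_sum_plus, sym_sum_scal, IH.
    rewrite (sym_sum_even (fun i => a (S N - i)%nat)).
    pose proof (sum_rev a (S N)) as HR. rewrite (tech5 (fun k => a (S N - k)%nat)) in HR.
    rewrite Nat.sub_diag in HR. rewrite Nat.sub_0_r.
    replace (sum_f_R0 (fun k => a (S N - k)%nat) N)
      with (sum_f_R0 a (S N) - a 0%nat) by lra.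
    rewrite tech5. simpl sum_f_R0. ring.
Qed.

Definition bessel_term (nu : nat) (y : R) (m : nat) : R :=
  y ^ (2 * m) / (INR (fact m) * INR (fact (nu + m))).

(** The even series J_nu of the overview, at y = x / 2. Splitting off the power (x / 2)^nu leaves a
    factor whose dependence on nu is comparable with 1 / nu!. *)
Definition bessel_red (nu : nat) (y : R) : R := Series (bessel_term nu y).

Lemma fact_mul_le (n m : nat) : (fact n * fact m <= fact (n + m))%nat.
Proof.
  induction m as [|m IH].
  - rewrite Nat.add_0_r. simpl. lia.
  - rewrite Nat.add_succ_r. simpl fact. nia.
Qed.

Lemma fact_ge_1 (n : nat) : 1 <= INR (fact n).
Proof. apply (le_INR 1). apply lt_O_fact. Qed.

Lemma bessel_term_nonneg (nu : nat) (y : R) (m : nat) : 0 <= bessel_term nu y m.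
Proof.
  unfold bessel_term. rewrite pow_mult. apply Rmult_le_pos.
  - apply pow_le. nra.
  - apply Rlt_le, Rinv_0_lt_compat, Rmult_lt_0_compat; apply INR_fact_lt_0.
Qed.

Lemma bessel_term_le (nu : nat) (y : R) (m : nat) :
  bessel_term nu y m <= / INR (fact nu) * exp_term (y ^ 2) m.
Proof.
  unfold bessel_term, exp_term. rewrite pow_mult.
  assert (H0 : 0 <= (y ^ 2) ^ m) by (apply pow_le; nra).
  pose proof (fact_mul_le nu m) as Hf. apply le_INR in Hf. rewrite mult_INR in Hf.
  pose proof (fact_ge_1 nu) as Hn. pose proof (fact_ge_1 m) as Hm.
  pose proof (fact_ge_1 (nu + m)) as Hnm.
  replace (/ INR (fact nu) * ((y ^ 2) ^ m / INR (fact m)))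
    with ((y ^ 2) ^ m * / (INR (fact m) * INR (fact nu))) by (field; lra).
  apply Rmult_le_compat_l; [exact H0|].
  apply Rinv_le_contravar; nra.
Qed.

Lemma ex_series_nonneg_le (a b : nat -> R) :
  (forall m, 0 <= a m <= b m) -> ex_series b -> ex_series a.
Proof.
  intros H Hb. apply (@ex_series_le R_AbsRing R_CompleteNormedModule a b); [|exact Hb].
  intros n. specialize (H n). change (norm (a n)) with (Rabs (a n)).
  rewrite Rabs_pos_eq; lra.
Qed.

Lemma bessel_term_ex (nu : nat) (y : R) : ex_series (bessel_term nu y).
Proof.
  apply ex_series_nonneg_le with (fun m => / INR (fact nu) * exp_term (y ^ 2) m).
  - intros m. split; [apply bessel_term_nonneg|apply bessel_term_le].
  - apply (ex_series_scal_l (/ INR (fact nu)) (exp_term (y ^ 2))).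
    eexists. apply exp_term_series.
Qed.

(** The partial sums are written as products of two exponential terms whose indices differ by nu:
    these are the diagonals of [exp_square]. *)
Lemma besselI_cv (nu : nat) (x : R) :
  Un_cv (sum_f_R0 (fun m => exp_term (x / 2) m * exp_term (x / 2) (m + nu)))
        ((x / 2) ^ nu * bessel_red nu (x / 2)).
Proof.
  pose proof (is_series_scal_R ((x / 2) ^ nu) _ _
    (Series_correct _ (bessel_term_ex nu (x / 2)))) as H.
  apply is_series_Reals in H.
  intros e He. destruct (H e He) as [N HN]. exists N. intros n Hn.
  specialize (HN n Hn). erewrite sum_eq; [exact HN|].
  intros i _. unfold bessel_term, exp_term.
  rewrite (Nat.add_comm nu i), pow_add.
  replace (2 * i)%nat with (i + i)%nat by lia. rewrite pow_add.
  field. split; apply INR_fact_neq_0.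
Qed.

Lemma besselI_red (nu : nat) (x : R) :
  besselI nu x = (x / 2) ^ nu * bessel_red nu (x / 2).
Proof.
  apply lim_seq_eq. eapply Un_cv_ext; [|apply besselI_cv].
  intros n. apply sum_eq. intros i _. unfold exp_term.
  rewrite (Nat.add_comm nu i).
  replace (2 * i + nu)%nat with (i + (i + nu))%nat by lia. rewrite !pow_add.
  field. split; apply INR_fact_neq_0.
Qed.

(** The term m = 0 of a nonnegative series. Its factor 1 / nu! is the one in the upper bounds and in
    the Taylor remainder, which makes the quotients bounded uniformly in nu. *)
Lemma bessel_red_lower (nu : nat) (y : R) : / INR (fact nu) <= bessel_red nu y.
Proof.
  unfold bessel_red. rewrite Series_incr_1 by apply bessel_term_ex.
  assert (H : 0 <= Series (fun k => bessel_term nu y (S k))).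
  { rewrite <- (Rmult_0_l (Series (fun k => bessel_term nu y (S k)))), <- Series_scal_l.
    apply Series_le; [|apply (ex_series_incr_1 (bessel_term nu y)), bessel_term_ex].
    intros n. pose proof (bessel_term_nonneg nu y (S n)). lra. }
  unfold bessel_term at 1. rewrite Nat.add_0_r. simpl pow. simpl (INR (fact 0)).
  unfold Rdiv. rewrite !Rmult_1_l. lra.
Qed.

Lemma bessel_red_pos (nu : nat) (y : R) : 0 < bessel_red nu y.
Proof.
  eapply Rlt_le_trans; [|apply bessel_red_lower].
  apply Rinv_0_lt_compat, INR_fact_lt_0.
Qed.

Lemma bessel_red_upper (nu : nat) (y : R) :
  bessel_red nu y <= / INR (fact nu) * exp (y ^ 2).
Proof.
  rewrite <- (is_series_unique _ _ (exp_term_series (y ^ 2))), <- Series_scal_l.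
  apply Series_le.
  - intros m. split; [apply bessel_term_nonneg|apply bessel_term_le].
  - apply (ex_series_scal_l (/ INR (fact nu)) (exp_term (y ^ 2))).
    eexists. apply exp_term_series.
Qed.

Lemma bessel_red_decr (nu : nat) (y : R) : bessel_red (S nu) y <= bessel_red nu y.
Proof.
  apply Series_le; [|apply bessel_term_ex].
  intros m. split; [apply bessel_term_nonneg|].
  unfold bessel_term. apply Rmult_le_compat_l; [rewrite pow_mult; apply pow_le; nra|].
  pose proof (fact_ge_1 m). pose proof (fact_ge_1 (nu + m)).
  apply Rinv_le_contravar; [nra|].
  apply Rmult_le_compat_l; [lra|].
  apply le_INR. simpl. nia.
Qed.

(** Since m / m! = 1 / (m - 1)!, shifting the index raises nu by one. Multiplied by 2 / y this is
    the termwise derivative, J_nu' = 2 y J_(nu+1). *)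
Lemma bessel_red_shift (nu : nat) (y : R) :
  is_series (fun m => INR m * bessel_term nu y m) (y ^ 2 * bessel_red (S nu) y).
Proof.
  apply (is_series_decr_1 (fun m => INR m * bessel_term nu y m)).
  match goal with |- is_series _ ?l => replace l with (y ^ 2 * bessel_red (S nu) y) end.
  2: { unfold plus, opp; simpl. ring. }
  eapply is_series_ext_R; [|apply is_series_scal_R, Series_correct, bessel_term_ex].
  intros n. unfold bessel_term.
  replace (nu + S n)%nat with (S nu + n)%nat by lia.
  replace (2 * S n)%nat with (2 * n + 2)%nat by lia.
  rewrite pow_add, fact_simpl, mult_INR, S_INR.
  pose proof (pos_INR n). pose proof (INR_fact_neq_0 n).
  pose proof (INR_fact_neq_0 (S nu + n)). field. repeat split; lra.
Qed.

(** Termwise, nu + 1 = (nu + 1 + n) - n: the first part cancels a factor of the factorial and gives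
    J_nu, the second is [bessel_red_shift]. *)
Lemma bessel_red_rec (nu : nat) (y : R) :
  INR (S nu) * bessel_red (S nu) y = bessel_red nu y - y ^ 2 * bessel_red (S (S nu)) y.
Proof.
  unfold bessel_red at 1. rewrite <- Series_scal_l.
  apply is_series_unique.
  eapply is_series_ext_R;
    [|exact (is_series_minus_R _ _ _ _ (Series_correct _ (bessel_term_ex nu y))
               (bessel_red_shift (S nu) y))].
  intros n. unfold bessel_term.
  replace (fact (S nu + n)) with (S (nu + n) * fact (nu + n))%nat by reflexivity.
  rewrite mult_INR, !S_INR, plus_INR.
  pose proof (pos_INR n). pose proof (pos_INR nu). pose proof (INR_fact_neq_0 n).
  pose proof (INR_fact_neq_0 (nu + n)). field. repeat split; lra.
Qed.

(** The remainders satisfy R_(n+1) = b R_n + n a^(n-1) (b - a)^2. The bound n^2 is crude, but it is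
    absorbed into a geometric factor. For n = 0 the value [pred 0 = 0] is multiplied by [INR 0]. *)
Lemma pow_taylor (a b : R) (n : nat) :
  0 <= a <= 1 -> 0 <= b <= 1 ->
  Rabs (b ^ n - a ^ n - INR n * a ^ pred n * (b - a)) <= INR n ^ 2 * (b - a) ^ 2.
Proof.
  intros Ha Hb. induction n as [|n IH].
  - simpl. replace (1 - 1 - 0 * 1 * (b - a)) with 0 by ring. rewrite Rabs_R0. lra.
  - simpl pred.
    replace (b ^ S n - a ^ S n - INR (S n) * a ^ n * (b - a))
      with (b * (b ^ n - a ^ n - INR n * a ^ pred n * (b - a))
            + INR n * a ^ pred n * (b - a) ^ 2).
    2: { rewrite S_INR. destruct n as [|n]; [simpl; ring|]. simpl pred. simpl pow. ring. }
    eapply Rle_trans; [apply Rabs_triang|]. rewrite Rabs_mult, (Rabs_pos_eq b) by lra.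
    assert (Hp : 0 <= a ^ pred n <= 1).
    { split; [now apply pow_le|]. rewrite <- (pow1 (pred n)). now apply pow_incr. }
    pose proof (pos_INR n) as Hn. rewrite S_INR.
    pose proof (pow2_ge_0 (b - a)) as Hs.
    rewrite (Rabs_pos_eq (INR n * _ * _)) by (apply Rmult_le_pos; [nra|exact Hs]).
    set (A := Rabs _) in *. pose proof (Rabs_pos (b ^ n - a ^ n - INR n * a ^ pred n * (b - a))) as HA.
    fold A in HA.
    assert (b * A <= INR n ^ 2 * (b - a) ^ 2) by nra.
    assert (INR n * a ^ pred n * (b - a) ^ 2 <= INR n * (b - a) ^ 2)
      by (apply Rmult_le_compat_r; nra).
    nra.
Qed.

Lemma sq_le_pow4 (n : nat) : INR n ^ 2 <= 4 ^ n.
Proof.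
  assert (H : INR n <= 2 ^ n).
  { induction n as [|n IH]; [simpl; lra|]. rewrite S_INR. simpl pow.
    pose proof (pow_R1_Rle 2 n). lra. }
  replace (4 ^ n) with ((2 ^ n) ^ 2).
  - apply pow_incr. split; [apply pos_INR|exact H].
  - replace 4 with (2 ^ 2) by ring. now rewrite <- !pow_mult, Nat.mul_comm.
Qed.

(** [pow_taylor] is applied to each power 2n. Then (2n)^2 <= 4 * 4^n, and (nu + n)! >= nu! n! leaves
    the exponential series at 4, whence the constant 4 exp 4 / nu!. The derivative series comes from
    [bessel_red_shift] scaled by 2 / a, so a is kept positive. *)
Lemma bessel_red_taylor (nu : nat) (a b : R) :
  0 < a <= 1 -> 0 <= b <= 1 ->
  Rabs (bessel_red nu b - bessel_red nu a - 2 * a * bessel_red (S nu) a * (b - a))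
  <= 4 * exp 4 * / INR (fact nu) * (b - a) ^ 2.
Proof.
  intros Ha Hb.
  pose proof (is_series_minus_R _ _ _ _ (Series_correct _ (bessel_term_ex nu b))
                (Series_correct _ (bessel_term_ex nu a))) as H.
  pose proof (is_series_scal_R (2 / a * (b - a)) _ _ (bessel_red_shift nu a)) as H2.
  pose proof (is_series_minus_R _ _ _ _ H H2) as H3. clear H H2.
  fold (bessel_red nu a) (bessel_red nu b) in H3.
  match type of H3 with is_series ?u _ => set (w := u) in H3 end.
  replace (bessel_red nu b - bessel_red nu a - 2 * a * bessel_red (S nu) a * (b - a))
    with (Series w) by (rewrite (is_series_unique _ _ H3); field; lra).
  set (c := 4 * / INR (fact nu) * (b - a) ^ 2).
  pose proof (is_series_scal_R c _ _ (exp_term_series 4)) as H4.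
  replace (4 * exp 4 * / INR (fact nu) * (b - a) ^ 2) with (c * exp 4) by (unfold c; ring).
  rewrite <- (is_series_unique _ _ H4).
  assert (Hw : forall n, Rabs (w n) <= c * exp_term 4 n).
  { intros n. unfold w, c, bessel_term, exp_term.
    pose proof (fact_ge_1 nu) as F1. pose proof (fact_ge_1 n) as F2.
    pose proof (fact_mul_le nu n) as F3. apply le_INR in F3. rewrite mult_INR in F3.
    match goal with |- Rabs ?e <= _ =>
      replace e with ((b ^ (2 * n) - a ^ (2 * n) - INR (2 * n) * a ^ pred (2 * n) * (b - a))
                      * / (INR (fact n) * INR (fact (nu + n)))) end.
    2: { rewrite mult_INR. simpl (INR 2). destruct n as [|n].
         - simpl. field. split; [apply INR_fact_neq_0|lra].
         - replace (2 * S n)%nat with (S (S (2 * n))) by lia.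
           cbn [Nat.pred]. rewrite <- !tech_pow_Rmult. field.
           repeat split; try apply INR_fact_neq_0. lra. }
    rewrite Rabs_mult, (Rabs_pos_eq (/ _))
      by (apply Rlt_le, Rinv_0_lt_compat, Rmult_lt_0_compat; apply INR_fact_lt_0).
    pose proof (pow_taylor a b (2 * n) ltac:(lra) Hb) as HT.
    pose proof (sq_le_pow4 n) as H4n.
    rewrite mult_INR in HT at 2. simpl (INR 2) in HT.
    pose proof (pow2_ge_0 (b - a)) as Hs.
    assert (HT2 : Rabs (b ^ (2 * n) - a ^ (2 * n) - INR (2 * n) * a ^ pred (2 * n) * (b - a))
                  <= 4 * 4 ^ n * (b - a) ^ 2) by nra.
    replace (4 * / INR (fact nu) * (b - a) ^ 2 * (4 ^ n / INR (fact n)))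
      with (4 * 4 ^ n * (b - a) ^ 2 * / (INR (fact n) * INR (fact nu))).
    2: { field. split; apply INR_fact_neq_0. }
    apply Rmult_le_compat; [apply Rabs_pos| |exact HT2|].
    - apply Rlt_le, Rinv_0_lt_compat, Rmult_lt_0_compat; apply INR_fact_lt_0.
    - apply Rinv_le_contravar; [nra|]. apply Rmult_le_compat_l; nra. }
  eapply Rle_trans; [apply Series_Rabs|].
  - apply ex_series_nonneg_le with (fun n => c * exp_term 4 n).
    + intros n. split; [apply Rabs_pos|apply Hw].
    + eexists; exact H4.
  - apply Series_le; [|eexists; exact H4].
    intros n. split; [apply Rabs_pos|apply Hw].
Qed.

(** * Moments of an increment *)

Lemma besselI_pos (nu : nat) (x : R) : 0 < x -> 0 < besselI nu x.
Proof.
  intros H. rewrite besselI_red. apply Rmult_lt_0_compat; [|apply bessel_red_pos].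
  apply pow_lt. lra.
Qed.

Lemma besselI_nonneg (nu : nat) (x : R) : 0 <= x -> 0 <= besselI nu x.
Proof.
  intros H. rewrite besselI_red. apply Rmult_le_pos; [|apply Rlt_le, bessel_red_pos].
  apply pow_le. lra.
Qed.

Lemma besselI_rec (nu : nat) (x : R) :
  INR (S nu) * besselI (S nu) x = x / 2 * (besselI nu x - besselI (S (S nu)) x).
Proof.
  rewrite !besselI_red. pose proof (bessel_red_rec nu (x / 2)) as H.
  rewrite <- !tech_pow_Rmult.
  replace (INR (S nu) * (x / 2 * (x / 2) ^ nu * bessel_red (S nu) (x / 2)))
    with (x / 2 * (x / 2) ^ nu * (INR (S nu) * bessel_red (S nu) (x / 2))) by ring.
  rewrite H. ring.
Qed.

(** The ratio is x / 2 times J_(nu+1) / J_nu, and J decreases in nu. This is the only size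
    information on h that is used. *)
Lemma besselI_ratio_bounds (nu : nat) (x : R) :
  0 < x -> 0 <= besselI (S nu) x / besselI nu x <= x / 2.
Proof.
  intros H. pose proof (besselI_pos nu x H). pose proof (besselI_pos (S nu) x H).
  split.
  - apply Rlt_le, Rdiv_lt_0_compat; assumption.
  - apply Rle_div_l; [assumption|].
    rewrite !besselI_red, <- tech_pow_Rmult, Rmult_assoc.
    apply Rmult_le_compat_l; [lra|]. apply Rmult_le_compat_l; [apply pow_le; lra|].
    apply bessel_red_decr.
Qed.

(** The convention I_(-k) = I_k makes the three-term recurrence valid at every integer, 0
    included. *)
Definition zbessel (x : R) (k : Z) : R := besselI (Z.abs_nat k) x.

Lemma zbessel_opp (x : R) (k : Z) : zbessel x (- k) = zbessel x k.
Proof. unfold zbessel. f_equal. lia. Qed.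

Lemma zbessel_rec_pos (x : R) (k : Z) : (0 < k)%Z ->
  IZR k * zbessel x k = x / 2 * (zbessel x (k - 1) - zbessel x (k + 1)).
Proof.
  intros Hk. unfold zbessel. destruct (Z.abs_nat k) as [|n] eqn:E; [lia|].
  replace (Z.abs_nat (k - 1)) with n by lia.
  replace (Z.abs_nat (k + 1)) with (S (S n)) by lia.
  replace k with (Z.of_nat (S n)) by lia. rewrite <- INR_IZR_INZ. apply besselI_rec.
Qed.

Lemma zbessel_rec (x : R) (k : Z) :
  IZR k * zbessel x k = x / 2 * (zbessel x (k - 1) - zbessel x (k + 1)).
Proof.
  destruct (Z.lt_trichotomy k 0) as [Hk|[->|Hk]].
  - pose proof (zbessel_rec_pos x (- k) ltac:(lia)) as H.
    replace (- k - 1)%Z with (- (k + 1))%Z in H by lia.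
    replace (- k + 1)%Z with (- (k - 1))%Z in H by lia.
    rewrite !zbessel_opp, opp_IZR in H. lra.
  - change (0 - 1)%Z with (- (0 + 1))%Z. rewrite zbessel_opp. ring.
  - now apply zbessel_rec_pos.
Qed.

(** For k <> 0 the recurrence at |k| trades |k| I_k for a difference of neighbours, and adding the
    term in I_(|k|+1) restores the symmetry. The result is x / 2 times a second difference, so its
    sum over k telescopes. *)
Lemma zbessel_abs_rec (x : R) (k : Z) :
  IZR (Z.abs k) * zbessel x k + x * besselI (S (Z.abs_nat k)) x - x * zbessel x k
  = x / 2 * ((zbessel x (k + 1) - zbessel x k) - (zbessel x (k - 1 + 1) - zbessel x (k - 1))).
Proof.
  replace (k - 1 + 1)%Z with k by lia.
  pose proof (zbessel_rec x k) as H.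
  destruct (Z.lt_trichotomy k 0) as [Hk|[->|Hk]].
  - rewrite (Z.abs_neq k) by lia. rewrite opp_IZR.
    replace (besselI (S (Z.abs_nat k)) x) with (zbessel x (k - 1))
      by (unfold zbessel; f_equal; lia). lra.
  - change (0 - 1)%Z with (- (0 + 1))%Z. rewrite zbessel_opp. simpl Z.abs.
    change (besselI (S (Z.abs_nat 0)) x) with (zbessel x (0 + 1)). lra.
  - rewrite (Z.abs_eq k) by lia.
    replace (besselI (S (Z.abs_nat k)) x) with (zbessel x (k + 1))
      by (unfold zbessel; f_equal; lia). lra.
Qed.

Lemma sym_sum_cv (K : nat) (c : nat -> Z -> R) (l : Z -> R) :
  (forall z, Un_cv (fun M => c M z) (l z)) ->
  Un_cv (fun M => sym_sum K (c M)) (sym_sum K l).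
Proof.
  intros H. induction K as [|K IH]; [apply H|].
  rewrite sym_sum_S.
  apply Un_cv_ext with
    (fun M => sym_sum K (c M) + c M (Z.of_nat (S K)) + c M (- Z.of_nat (S K))%Z).
  - intros M. now rewrite sym_sum_S.
  - apply CV_plus; [apply CV_plus|]; auto.
Qed.

Lemma exp_term_sum_le (y : R) (N : nat) : 0 <= y -> sum_f_R0 (exp_term y) N <= exp y.
Proof.
  intros H. apply growing_ineq; [|apply exp_term_cv].
  intros n. rewrite tech5. pose proof (exp_term_nonneg y (S n) H). lra.
Qed.

Lemma exp_term_prod_sum_le (x : R) (nu N : nat) : 0 <= x ->
  sum_f_R0 (fun m => exp_term (x / 2) m * exp_term (x / 2) (m + nu)) N <= besselI nu x.
Proof.
  intros H. rewrite besselI_red.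
  apply (growing_ineq _ _ ) with (2 := besselI_cv nu x).
  intros n. rewrite tech5.
  pose proof (exp_term_nonneg (x / 2) (S n) ltac:(lra)).
  pose proof (exp_term_nonneg (x / 2) (S n + nu) ltac:(lra)). nra.
Qed.

(** A squeeze with exp x = (exp (x / 2))^2. The square [0, N]^2 of exponential terms, cut into
    diagonals, lies below the sum of the full Bessel series. Conversely, finitely many diagonals
    truncated at M fit into the square of side M + K, and M tends to infinity. *)
Lemma zbessel_mass (x : R) : 0 <= x -> Un_cv (fun K => sym_sum K (zbessel x)) (exp x).
Proof.
  intros Hx. set (y := x / 2). assert (Hy : 0 <= y) by (unfold y; lra).
  set (c := fun M nu => sum_f_R0 (fun m => exp_term y m * exp_term y (m + nu)%nat) M).
  assert (He : exp x = exp y * exp y) by (rewrite <- exp_plus; f_equal; unfold y; lra).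
  assert (Hlow : forall N, (sum_f_R0 (exp_term y) N) ^ 2 <= sym_sum N (zbessel x)).
  { intros N. rewrite <- exp_square. apply sym_sum_le. intros z _.
    now apply exp_term_prod_sum_le. }
  assert (Hpos : forall N, 0 <= sum_f_R0 (exp_term y) N).
  { intros N. apply cond_pos_sum. intros; now apply exp_term_nonneg. }
  assert (Hup : forall K, sym_sum K (zbessel x) <= exp x).
  { intros K. apply (@Rle_cv_lim (fun M => sym_sum K (fun z => c M (Z.abs_nat z)))
                       (fun _ => exp x)); [|apply sym_sum_cv|apply Un_cv_const].
    - intros M. apply Rle_trans with ((sum_f_R0 (exp_term y) (M + K)) ^ 2).
      + rewrite <- exp_square.
        assert (HK : sym_sum K (fun z => c M (Z.abs_nat z)) <=
           sym_sum K (fun k => c (M + K - Z.abs_nat k)%nat (Z.abs_nat k))).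
        { apply sym_sum_le. intros z Hz. unfold c.
          replace (M + K - Z.abs_nat z)%nat with (M + (K - Z.abs_nat z))%nat by lia.
          induction (K - Z.abs_nat z)%nat as [|j IH]; [rewrite Nat.add_0_r; lra|].
          rewrite Nat.add_succ_r, tech5.
          pose proof (exp_term_nonneg y (S (M + j)) Hy).
          pose proof (exp_term_nonneg y (S (M + j) + Z.abs_nat z) Hy). nra. }
        eapply Rle_trans; [exact HK|]. clear HK.
        (* The cut-off inside the summand is frozen as N, so that only the range of the outer sum
           grows, from K to M + K, by nonnegative terms. *)
        fold (c M). rewrite Nat.add_comm. generalize (K + M)%nat at 1 3. intros N.
        change (fun k : Z => sum_f_R0 _ _) with (fun k => c (N - Z.abs_nat k)%nat (Z.abs_nat k)).
        rewrite Nat.add_comm. induction M as [|M IH]; [simpl; lra|].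
        eapply Rle_trans; [exact IH|]. simpl Nat.add. apply sym_sum_growing.
        intros z. apply cond_pos_sum. intros m. apply Rmult_le_pos; now apply exp_term_nonneg.
      + rewrite He. pose proof (exp_term_sum_le y (M + K) Hy). pose proof (Hpos (M + K)%nat). nra.
    - intros z. unfold zbessel. rewrite besselI_red. apply besselI_cv. }
  assert (HT : Un_cv (fun N => (sum_f_R0 (exp_term y) N) ^ 2) (exp x)).
  { rewrite He. eapply Un_cv_ext; [|apply CV_mult; apply exp_term_cv].
    intros n. simpl. ring. }
  intros e Hep. destruct (HT e Hep) as [N HN]. exists N. intros n Hn.
  specialize (HN n Hn). unfold Rdist in *. specialize (Hlow n). specialize (Hup n).
  unfold Rabs in *. destruct (Rcase_abs _), (Rcase_abs _); lra.
Qed.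

Lemma INR_S_le_pow2 (n : nat) : INR (S n) <= 2 ^ n.
Proof.
  induction n as [|n IH]; [simpl; lra|]. rewrite S_INR. simpl pow.
  pose proof (pow_R1_Rle 2 n). lra.
Qed.

(** The cubic weight is what the fourth moment requires, since it sums by parts against k^3. As (K +
    1)^3 <= 8^K, the weight turns (x / 2)^K into (4 x)^K, still beaten by K!. *)
Lemma besselI_tail (x : R) : 0 <= x ->
  Un_cv (fun K => INR (S K) ^ 3 * besselI K x) 0.
Proof.
  intros Hx. apply Un_cv_squeeze0 with
    (fun K => exp ((x / 2) ^ 2) * ((4 * x) ^ K / INR (fact K))).
  - intros K. pose proof (besselI_nonneg K x Hx). pose proof (pos_INR (S K)).
    assert (0 <= INR (S K) ^ 3) by now apply pow_le.
    rewrite Rabs_pos_eq by (apply Rmult_le_pos; assumption).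
    rewrite besselI_red. replace (4 * x) with ((2 ^ 3) * (x / 2)) by field.
    rewrite Rpow_mult_distr, <- pow_mult, Nat.mul_comm, pow_mult.
    pose proof (bessel_red_upper K (x / 2)). pose proof (bessel_red_pos K (x / 2)).
    assert (0 <= (x / 2) ^ K) by (apply pow_le; lra).
    assert (INR (S K) ^ 3 <= (2 ^ K) ^ 3).
    { apply pow_incr. split; [assumption|apply INR_S_le_pow2]. }
    replace (exp ((x / 2) ^ 2) * ((2 ^ K) ^ 3 * (x / 2) ^ K / INR (fact K)))
      with ((2 ^ K) ^ 3 * ((x / 2) ^ K * (/ INR (fact K) * exp ((x / 2) ^ 2))))
      by (field; apply INR_fact_neq_0).
    apply Rmult_le_compat; try assumption.
    + apply Rmult_le_pos; lra.
    + apply Rmult_le_compat_l; lra.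
  - rewrite <- (Rmult_0_r (exp ((x / 2) ^ 2))).
    apply CV_mult; [apply Un_cv_const|apply cv_speed_pow_fact].
Qed.

Lemma sym_sum_bessel_by_parts (x : R) (c : Z -> R) :
  0 <= x -> (forall k, Rabs (c k) <= (IZR (Z.abs k)) ^ 3) ->
  Un_cv (fun K => sym_sum K (fun k => c k * (zbessel x (k - 1) - zbessel x (k + 1)))
                - sym_sum K (fun k => (c (k + 1)%Z - c (k - 1)%Z) * zbessel x k)) 0.
Proof.
  intros Hx Hc.
  pose proof (besselI_tail x Hx) as H0. pose proof (Un_cv_S _ _ H0) as H1.
  apply Un_cv_squeeze0 with (fun K => 2 * (INR (S K) ^ 3 * besselI K x)
     + 2 * (INR (S (S K)) ^ 3 * besselI (S K) x)).
  - intros K. rewrite sym_sum_by_parts.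
    replace (zbessel x (Z.of_nat (S K))) with (besselI (S K) x) by (unfold zbessel; f_equal; lia).
    replace (zbessel x (- Z.of_nat (S K))) with (besselI (S K) x) by (unfold zbessel; f_equal; lia).
    replace (zbessel x (Z.of_nat K)) with (besselI K x) by (unfold zbessel; f_equal; lia).
    replace (zbessel x (- Z.of_nat K)) with (besselI K x) by (unfold zbessel; f_equal; lia).
    pose proof (Hc (Z.of_nat (S K))) as C1. pose proof (Hc (- Z.of_nat K)%Z) as C2.
    pose proof (Hc (Z.of_nat K)) as C3. pose proof (Hc (- Z.of_nat (S K))%Z) as C4.
    rewrite Z.abs_opp in C2, C4. rewrite Z.abs_eq in C1, C2, C3, C4 by lia.
    rewrite <- INR_IZR_INZ in C1, C2, C3, C4.
    pose proof (besselI_nonneg K x Hx) as B0. pose proof (besselI_nonneg (S K) x Hx) as B1.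
    assert (P1 : INR K ^ 3 <= INR (S K) ^ 3)
      by (apply pow_incr; rewrite S_INR; pose proof (pos_INR K); lra).
    assert (P2 : INR (S K) ^ 3 <= INR (S (S K)) ^ 3)
      by (apply pow_incr; rewrite (S_INR (S K)); pose proof (pos_INR (S K)); lra).
    assert (P3 : INR K ^ 3 <= INR (S (S K)) ^ 3) by lra.
    assert (D : forall c p q b, Rabs c <= p -> p <= q -> 0 <= b -> Rabs (c * b) <= q * b).
    { intros c0 p q b Q1 Q2 Q3. rewrite Rabs_mult, (Rabs_pos_eq b) by assumption.
      apply Rmult_le_compat_r; lra. }
    pose proof (D _ _ _ _ C1 (Rle_refl _) B0) as D1.
    pose proof (D _ _ _ _ C2 P3 B1) as D2.
    pose proof (D _ _ _ _ C3 P3 B1) as D3.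
    pose proof (D _ _ _ _ C4 (Rle_refl _) B0) as D4.
    apply Rabs_le_between in D1, D2, D3, D4. apply Rabs_le. lra.
  - replace 0 with (2 * 0 + 2 * 0) by ring.
    apply CV_plus; apply CV_mult; try apply Un_cv_const; assumption.
Qed.

(** A relation rather than a value of [zsum]: existence of the limit and its value travel
    together. *)
Definition is_mean (p g : Z -> R) (l : R) : Prop :=
  Un_cv (fun K => sym_sum K (fun k => p k * g k)) l.

Lemma is_mean_ext (p g g' : Z -> R) (l : R) :
  (forall k, g k = g' k) -> is_mean p g l -> is_mean p g' l.
Proof.
  intros E. apply Un_cv_ext. intros K. apply sym_sum_ext. intros z _. now rewrite E.
Qed.

Lemma is_mean_plus (p g g' : Z -> R) (l l' : R) :
  is_mean p g l -> is_mean p g' l' -> is_mean p (fun k => g k + g' k) (l + l').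
Proof.
  intros H H'. eapply Un_cv_ext; [|exact (CV_plus _ _ _ _ H H')].
  intros K. cbv beta. rewrite <- sym_sum_plus. apply sym_sum_ext. intros; ring.
Qed.

Lemma is_mean_scal (p g : Z -> R) (c l : R) :
  is_mean p g l -> is_mean p (fun k => c * g k) (c * l).
Proof.
  intros H. eapply Un_cv_ext; [|exact (CV_mult _ _ _ _ (Un_cv_const c) H)].
  intros K. cbv beta. rewrite <- sym_sum_scal. apply sym_sum_ext. intros; ring.
Qed.

Lemma is_mean_le (p g g' : Z -> R) (l l' : R) :
  (forall k, 0 <= p k) -> (forall k, g k <= g' k) ->
  is_mean p g l -> is_mean p g' l' -> l <= l'.
Proof.
  intros Hp Hg H H'. eapply (@Rle_cv_lim _ _ l l'); [|exact H|exact H'].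
  intros K. apply sym_sum_le. intros z _. now apply Rmult_le_compat_l.
Qed.

Lemma is_mean_sym_sum_le (p g : Z -> R) (l : R) (K : nat) :
  (forall k, 0 <= p k) -> (forall k, 0 <= g k) ->
  is_mean p g l -> sym_sum K (fun k => p k * g k) <= l.
Proof.
  intros Hp Hg H. apply (growing_ineq _ _) with (2 := H).
  intros n. apply sym_sum_growing. intros z. now apply Rmult_le_pos.
Qed.

(** The function g + G lies between 0 and 2 G, so its partial sums are monotone and bounded;
    subtracting G recovers g. *)
Lemma is_mean_dominated (p g G : Z -> R) (L : R) :
  (forall k, 0 <= p k) -> (forall k, Rabs (g k) <= G k) -> is_mean p G L ->
  exists l, is_mean p g l /\ Rabs l <= L.
Proof.
  intros Hp Hg HG.
  assert (HG0 : forall k, 0 <= G k)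
    by (intros k; eapply Rle_trans; [apply Rabs_pos|apply Hg]).
  destruct (growing_bounded_cv (fun K => sym_sum K (fun k => p k * (g k + G k))) (2 * L))
    as [l [Hl _]].
  - intros K. apply sym_sum_growing. intros z. apply Rmult_le_pos; [apply Hp|].
    specialize (Hg z). apply Rabs_le_between in Hg. lra.
  - intros K. pose proof (is_mean_sym_sum_le p G L K Hp HG0 HG) as H.
    apply Rle_trans with (2 * sym_sum K (fun k => p k * G k)); [|lra].
    rewrite <- sym_sum_scal. apply sym_sum_le. intros z _.
    specialize (Hg z). apply Rabs_le_between in Hg. specialize (Hp z). nra.
  - assert (Hm : is_mean p g (l + -1 * L)).
    { eapply is_mean_ext; [|exact (is_mean_plus _ _ _ _ _ Hl (is_mean_scal _ _ (-1) _ HG))].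
      intros k. simpl. ring. }
    exists (l + -1 * L). split; [exact Hm|]. apply Rabs_le. split.
    + replace (- L) with (-1 * L) by ring.
      eapply is_mean_le; [exact Hp| |apply is_mean_scal; exact HG|exact Hm].
      intros k. specialize (Hg k). apply Rabs_le_between in Hg. simpl. lra.
    + eapply is_mean_le; [exact Hp| |exact Hm|exact HG].
      intros k. specialize (Hg k). apply Rabs_le_between in Hg. lra.
Qed.

Section Increments.
Variables (D th : R).
Hypothesis (Hlam : 0 < th * D).
Local Notation lam := (th * D).
Local Notation p := (fD D th).

Lemma fD_zbessel (k : Z) : p k = exp (- lam) * zbessel lam k.
Proof. reflexivity. Qed.

Lemma fD_pos (k : Z) : 0 < p k.
Proof.
  apply Rmult_lt_0_compat; [apply exp_pos|]. now apply besselI_pos.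
Qed.

Lemma fD_nonneg (k : Z) : 0 <= p k.
Proof. apply Rlt_le, fD_pos. Qed.

Lemma fD_mass : is_mean p (fun _ => 1) 1.
Proof.
  assert (E : exp (- lam) * exp lam = 1) by (rewrite <- exp_plus, Rplus_opp_l; apply exp_0).
  enough (H : is_mean p (fun _ => 1) (exp (- lam) * exp lam)) by now rewrite E in H.
  eapply Un_cv_ext;
    [|exact (CV_mult _ _ _ _ (Un_cv_const (exp (- lam))) (zbessel_mass lam ltac:(lra)))].
  intros K. cbv beta. rewrite <- sym_sum_scal. apply sym_sum_ext. intros z _.
  rewrite fD_zbessel. ring.
Qed.

(** A Stein identity for the increment law, E (c(k) k) = lam / 2 * E (c(k+1) - c(k-1)). Each use on
    a monomial lowers the degree by two, so the even moments follow from the total mass. *)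
Lemma fD_by_parts (c : Z -> R) (l : R) :
  (forall k, Rabs (c k) <= (IZR (Z.abs k)) ^ 3) ->
  is_mean p (fun k => c (k + 1)%Z - c (k - 1)%Z) l ->
  is_mean p (fun k => c k * IZR k) (lam / 2 * l).
Proof.
  intros Hc H. pose proof (sym_sum_bessel_by_parts lam c ltac:(lra) Hc) as HB.
  pose proof (CV_plus _ _ _ _ (CV_mult _ _ _ _ (Un_cv_const (exp (- lam))) HB) H) as H1.
  pose proof (CV_mult _ _ _ _ (Un_cv_const (lam / 2)) H1) as H2.
  replace (lam / 2 * l) with (lam / 2 * (exp (- lam) * 0 + l)) by ring.
  eapply Un_cv_ext; [|exact H2].
  intros K. cbv beta.
  rewrite (sym_sum_ext K (fun k => p k * (c (k + 1)%Z - c (k - 1)%Z))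
    (fun k => exp (- lam) * ((c (k + 1)%Z - c (k - 1)%Z) * zbessel lam k)))
    by (intros; rewrite fD_zbessel; ring).
  rewrite sym_sum_scal.
  rewrite (sym_sum_ext K (fun k => p k * (c k * IZR k))
    (fun k => lam / 2 * exp (- lam) * (c k * (zbessel lam (k - 1) - zbessel lam (k + 1))))).
  - rewrite sym_sum_scal. ring.
  - intros z _. rewrite fD_zbessel.
    replace (exp (- lam) * zbessel lam z * (c z * IZR z))
      with (exp (- lam) * c z * (IZR z * zbessel lam z)) by ring.
    rewrite zbessel_rec. ring.
Qed.

Lemma IZR_abs_cube (k : Z) : Rabs (IZR k) <= IZR (Z.abs k) ^ 3.
Proof.
  rewrite <- abs_IZR.
  destruct (Z.eq_dec (Z.abs k) 0) as [E|E].
  - rewrite E. lra.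
  - assert (1 <= IZR (Z.abs k)) by (apply IZR_le; lia). nra.
Qed.

Lemma fD_moment2 : is_mean p (fun k => IZR k ^ 2) lam.
Proof.
  replace lam with (lam / 2 * (2 * 1)) by field.
  apply is_mean_ext with (fun k => IZR k * IZR k); [intros; ring|].
  apply (fD_by_parts IZR); [apply IZR_abs_cube|].
  eapply is_mean_ext; [|exact (is_mean_scal _ _ 2 _ fD_mass)].
  intros k. simpl. rewrite plus_IZR, minus_IZR. ring.
Qed.

Lemma fD_moment4 : is_mean p (fun k => IZR k ^ 4) (3 * lam ^ 2 + lam).
Proof.
  replace (3 * lam ^ 2 + lam) with (lam / 2 * (6 * lam + 2 * 1)) by field.
  apply is_mean_ext with (fun k => IZR k ^ 3 * IZR k); [intros; ring|].
  apply (fD_by_parts (fun k => IZR k ^ 3)).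
  - intros k. rewrite <- RPow_abs, <- abs_IZR. lra.
  - eapply is_mean_ext; [|exact (is_mean_plus _ _ _ _ _
       (is_mean_scal _ _ 6 _ fD_moment2) (is_mean_scal _ _ 2 _ fD_mass))].
    intros k. simpl. rewrite plus_IZR, minus_IZR. ring.
Qed.

Lemma hD_bounds (k : Z) : 0 <= hD D th k <= lam / 2.
Proof. apply besselI_ratio_bounds. exact Hlam. Qed.

(* [th] times the score of one increment. *)
Lemma fD_score : is_mean p (fun k => IZR (Z.abs k) + lam * hD D th k - lam) 0.
Proof.
  pose proof (besselI_tail lam ltac:(lra)) as H0. pose proof (Un_cv_S _ _ H0) as H1.
  assert (HK : forall K, 1 <= INR (S K) ^ 3).
  { intros K. rewrite <- (pow1 3). apply pow_incr. rewrite S_INR.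
    pose proof (pos_INR K). lra. }
  apply Un_cv_squeeze0 with (fun K => exp (- lam) * lam * (INR (S K) ^ 3 * besselI K lam
     + INR (S (S K)) ^ 3 * besselI (S K) lam)).
  - intros K.
    (* By [zbessel_abs_rec] the summand is a multiple of [F (k + 1) - F k], so only boundary values
       near K and -K survive. *)
    set (F := fun k => zbessel lam k - zbessel lam (k - 1)).
    rewrite (sym_sum_ext K _ (fun k => exp (- lam) * (lam / 2) * (F (k + 1)%Z - F k))).
    + rewrite sym_sum_scal, sym_sum_telescope. unfold F.
      replace (zbessel lam (Z.of_nat (S K))) with (besselI (S K) lam) by (unfold zbessel; f_equal; lia).
      replace (zbessel lam (Z.of_nat (S K) - 1)) with (besselI K lam) by (unfold zbessel; f_equal; lia).
      replace (zbessel lam (- Z.of_nat K)) with (besselI K lam) by (unfold zbessel; f_equal; lia).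
      replace (zbessel lam (- Z.of_nat K - 1)) with (besselI (S K) lam) by (unfold zbessel; f_equal; lia).
      pose proof (besselI_nonneg K lam ltac:(lra)). pose proof (besselI_nonneg (S K) lam ltac:(lra)).
      pose proof (HK K). pose proof (HK (S K)). pose proof (exp_pos (- lam)).
      rewrite !Rabs_mult, !Rabs_pos_eq by lra. rewrite !Rmult_assoc.
      apply Rmult_le_compat_l; [lra|].
      assert (Rabs (besselI (S K) lam - besselI K lam - (besselI K lam - besselI (S K) lam))
              <= 2 * (INR (S K) ^ 3 * besselI K lam + INR (S (S K)) ^ 3 * besselI (S K) lam)).
      { apply Rabs_le. nra. }
      nra.
    + intros z _. unfold F. rewrite fD_zbessel. unfold hD. fold (zbessel lam z).
      pose proof (zbessel_abs_rec lam z) as H. pose proof (besselI_pos (Z.abs_nat z) lam Hlam) as Hp.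
      fold (zbessel lam z) in Hp.
      replace (z - 1 + 1)%Z with (z + 1 - 1)%Z in H by lia.
      replace (exp (- lam) * (lam / 2) * (zbessel lam (z + 1) - zbessel lam (z + 1 - 1)
                - (zbessel lam z - zbessel lam (z - 1))))
        with (exp (- lam) * (lam / 2 * (zbessel lam (z + 1) - zbessel lam z -
         (zbessel lam (z + 1 - 1) - zbessel lam (z - 1))))).
      2: { replace (z + 1 - 1)%Z with z by lia. ring. }
      rewrite <- H. field. lra.
  - rewrite <- (Rmult_0_r (exp (- lam) * lam)).
    apply CV_mult; [apply Un_cv_const|]. rewrite <- (Rplus_0_r 0).
    now apply CV_plus.
Qed.

(** The mean of h exists by domination, and the score identity then yields the mean of |k| as lam -
    lam E h. Since 0 <= h <= lam / 2, the gap lam - m is of second order. *)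
Lemma fD_mean_abs :
  exists m, is_mean p (fun k => IZR (Z.abs k)) m /\
    is_mean p (hD D th) (1 - m / lam) /\ 0 <= m <= lam /\ lam - m <= lam ^ 2.
Proof.
  destruct (is_mean_dominated p (hD D th) (fun _ => lam / 2 * 1) (lam / 2 * 1) fD_nonneg)
    as [h [Hh Hhb]].
  { intros k. pose proof (hD_bounds k). rewrite Rabs_pos_eq; lra. }
  { apply is_mean_scal, fD_mass. }
  apply Rabs_le_between in Hhb.
  assert (h0 : 0 <= h).
  { replace 0 with (0 * 1) by ring. eapply is_mean_le;
    [exact fD_nonneg| |apply is_mean_scal, fD_mass|exact Hh].
    intros k. pose proof (hD_bounds k). lra. }
  assert (Hm : is_mean p (fun k => IZR (Z.abs k)) (lam - lam * h)).
  { replace (lam - lam * h) with (0 + ((- lam) * h + lam * 1)) by ring.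
    eapply is_mean_ext; [|exact (is_mean_plus _ _ _ _ _ fD_score
      (is_mean_plus _ _ _ _ _ (is_mean_scal _ _ (- lam) _ Hh) (is_mean_scal _ _ lam _ fD_mass)))].
    intros k. simpl. ring. }
  exists (lam - lam * h). repeat split.
  - exact Hm.
  - replace (1 - (lam - lam * h) / lam) with h; [exact Hh|].
    revert Hlam. generalize lam. intros l Hl. field. lra.
  - replace 0 with (0 * 1) by ring. eapply is_mean_le;
    [exact fD_nonneg| |apply is_mean_scal, fD_mass|exact Hm].
    intros k. pose proof (IZR_le 0 (Z.abs k) ltac:(lia)). lra.
  - nra.
  - nra.
Qed.

End Increments.

(** * Taylor estimates *)

Lemma is_derive_minus_R (f g : R -> R) (x df dg : R) :
  is_derive f x df -> is_derive g x dg -> is_derive (fun t => f t - g t) x (df - dg).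
Proof. exact (is_derive_minus f g x df dg). Qed.

Lemma mvt_bound (f df : R -> R) (h B : R) :
  (forall t, Rmin 0 h <= t <= Rmax 0 h -> is_derive f t (df t)) ->
  (forall t, Rmin 0 h <= t <= Rmax 0 h -> Rabs (df t) <= B) ->
  Rabs (f h - f 0) <= B * Rabs h.
Proof.
  intros Hd HB. destruct (MVT_gen f 0 h df) as [c [Hc E]].
  - intros x Hx. apply Hd. lra.
  - intros x Hx. apply continuity_pt_filterlim, (ex_derive_continuous f).
    exists (df x). now apply Hd.
  - rewrite E, Rabs_mult, Rminus_0_r. apply Rmult_le_compat_r; [apply Rabs_pos|].
    now apply HB.
Qed.

Lemma Rabs_between_0 (t h : R) : Rmin 0 h <= t <= Rmax 0 h -> Rabs t <= Rabs h.
Proof.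
  unfold Rmin, Rmax, Rabs. destruct (Rle_dec 0 h), (Rcase_abs t), (Rcase_abs h); lra.
Qed.

(** The mean value theorem is applied to f(t) - t f1(0) and once more to its derivative, which costs
    the factor 1 / 2. The hypotheses are confined to the segment from 0 to h because the time
    expansion of [Phi] is available only for nonnegative times. *)
Lemma taylor1_bound (f f1 f2 : R -> R) (h B : R) :
  (forall t, Rmin 0 h <= t <= Rmax 0 h -> is_derive f t (f1 t)) ->
  (forall t, Rmin 0 h <= t <= Rmax 0 h -> is_derive f1 t (f2 t)) ->
  (forall t, Rmin 0 h <= t <= Rmax 0 h -> Rabs (f2 t) <= B) ->
  Rabs (f h - f 0 - h * f1 0) <= B * h ^ 2.
Proof.
  intros H1 H2 HB.
  assert (Hm : forall t, Rmin 0 h <= t <= Rmax 0 h ->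
            forall u, Rmin 0 t <= u <= Rmax 0 t -> Rmin 0 h <= u <= Rmax 0 h).
  { intros t. unfold Rmin, Rmax. destruct (Rle_dec 0 h), (Rle_dec 0 t); intros; lra. }
  assert (HB0 : 0 <= B).
  { eapply Rle_trans; [apply Rabs_pos|apply (HB 0)].
    unfold Rmin, Rmax. destruct (Rle_dec 0 h); lra. }
  pose proof (mvt_bound (fun t => f t - t * f1 0) (fun t => f1 t - f1 0) h (B * Rabs h)) as H.
  replace (f h - f 0 - h * f1 0) with (f h - h * f1 0 - (f 0 - 0 * f1 0)) by ring.
  replace (h ^ 2) with (Rabs h * Rabs h) by (rewrite <- Rabs_mult, Rabs_pos_eq; nra).
  rewrite <- Rmult_assoc. apply H.
  - intros t Ht. apply is_derive_minus_R; [now apply H1|].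
    auto_derive; [exact I|ring].
  - intros t Ht. eapply Rle_trans; [apply (mvt_bound f1 f2 t B)|].
    + intros u Hu. apply H2. now apply (Hm t).
    + intros u Hu. apply HB. now apply (Hm t).
    + apply Rmult_le_compat_l; [exact HB0|now apply Rabs_between_0].
Qed.

Lemma taylor2_bound (f f1 f2 f3 : R -> R) (h B : R) :
  (forall t, is_derive f t (f1 t)) -> (forall t, is_derive f1 t (f2 t)) ->
  (forall t, is_derive f2 t (f3 t)) -> (forall t, Rabs (f3 t) <= B) ->
  Rabs (f h - f 0 - h * f1 0 - h ^ 2 / 2 * f2 0) <= B * Rabs h ^ 3.
Proof.
  intros H1 H2 H3 HB.
  assert (HB0 : 0 <= B) by (eapply Rle_trans; [apply Rabs_pos|apply (HB 0)]).
  pose proof (mvt_bound (fun t => f t - t * f1 0 - t ^ 2 / 2 * f2 0)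
    (fun t => f1 t - f1 0 - t * f2 0) h (B * Rabs h ^ 2)) as H.
  replace (f h - f 0 - h * f1 0 - h ^ 2 / 2 * f2 0)
    with (f h - h * f1 0 - h ^ 2 / 2 * f2 0 - (f 0 - 0 * f1 0 - 0 ^ 2 / 2 * f2 0)) by field.
  replace (B * Rabs h ^ 3) with (B * Rabs h ^ 2 * Rabs h) by ring.
  apply H.
  - intros t _. apply is_derive_minus_R; [apply is_derive_minus_R; [apply H1|]|];
      auto_derive; trivial; field.
  - intros t Ht. eapply Rle_trans; [apply (taylor1_bound f1 f2 f3 t B); auto|].
    apply Rmult_le_compat_l; [exact HB0|].
    rewrite <- (pow2_abs t). apply pow_incr. split; [apply Rabs_pos|].
    now apply Rabs_between_0.
Qed.

Lemma ln_taylor2 (r : R) : Rabs r <= 1 / 2 ->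
  Rabs (ln (1 + r) - r + r ^ 2 / 2) <= 2 * Rabs r ^ 3.
Proof.
  intros H.
  pose proof (mvt_bound (fun t => ln (1 + t) - t + t ^ 2 / 2) (fun t => t ^ 2 / (1 + t))
    r (2 * Rabs r ^ 2)) as M.
  replace (ln (1 + r) - r + r ^ 2 / 2)
    with (ln (1 + r) - r + r ^ 2 / 2 - (ln (1 + 0) - 0 + 0 ^ 2 / 2))
    by (rewrite Rplus_0_r, ln_1; field).
  replace (2 * Rabs r ^ 3) with (2 * Rabs r ^ 2 * Rabs r) by ring.
  apply M; intros t Ht; apply Rabs_between_0 in Ht;
    assert (Ht2 : - (1 / 2) <= t <= 1 / 2) by (apply Rabs_le_between; lra).
  - auto_derive; [lra|]. field. lra.
  - rewrite Rabs_pos_eq.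
    + apply Rle_div_l; [lra|]. rewrite <- (pow2_abs t).
      pose proof (Rabs_pos t). assert (Rabs t ^ 2 <= Rabs r ^ 2) by (apply pow_incr; lra).
      assert (0 <= Rabs r ^ 2 * (t + 1 / 2)) by (apply Rmult_le_pos; [apply pow2_ge_0|lra]).
      lra.
    + apply Rmult_le_pos; [nra|]. apply Rlt_le, Rinv_0_lt_compat. lra.
Qed.

Lemma ln_taylor1 (r : R) : Rabs r <= 1 / 2 -> Rabs (ln (1 + r) - r) <= 2 * r ^ 2.
Proof.
  intros H. pose proof (ln_taylor2 r H) as H2. pose proof (pow2_abs r) as E.
  pose proof (Rabs_pos r) as Hp.
  replace (ln (1 + r) - r) with ((ln (1 + r) - r + r ^ 2 / 2) - r ^ 2 / 2) by ring.
  eapply Rle_trans; [apply Rabs_triang|]. rewrite Rabs_Ropp, (Rabs_pos_eq (r ^ 2 / 2)) by nra.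
  rewrite <- E at 2. rewrite <- E at 2. set (A := Rabs (ln _ - _ + _)) in *. clearbody A. nra.
Qed.

(** The constant of [bessel_red_taylor]. The recurring condition [bessel_const * Rabs r <= 1] forces
    |r| <= 1 / 4 and makes the quadratic remainder smaller than the linear term. *)
Definition bessel_const : R := 4 * exp 4.

Lemma bessel_const_ge : 4 <= bessel_const.
Proof. unfold bessel_const. pose proof (exp_ineq1_le 4). lra. Qed.

(** The power (x / 2)^nu contributes nu ln (1 + r) exactly. The reduced series contributes ln (1 +
    w) with w = x r h + O((x r)^2), the O being uniform in nu because the remainder carries 1 / nu!,
    which J_nu dominates. *)
Lemma besselI_log_ratio (nu : nat) (x r : R) :
  0 < x <= 1 -> bessel_const * Rabs r <= 1 ->
  Rabs (ln (besselI nu (x * (1 + r)) / besselI nu x)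
        - (INR nu * ln (1 + r) + x * r * (besselI (S nu) x / besselI nu x)))
  <= 2 * bessel_const * (x * r) ^ 2.
Proof.
  intros Hx Hr. pose proof bessel_const_ge as HC. pose proof (Rabs_pos r) as Hr0.
  assert (Hr4 : Rabs r <= 1 / 4) by nra.
  assert (Hr5 : - (1 / 4) <= r <= 1 / 4) by now apply Rabs_le_between.
  set (a := x / 2). set (b := a * (1 + r)).
  assert (Ha : 0 < a <= 1 / 2) by (unfold a; lra).
  assert (Hb : 0 < b <= 1) by (unfold b; nra).
  pose proof (bessel_red_taylor nu a b ltac:(lra) ltac:(lra)) as HT.
  fold bessel_const in HT.
  pose proof (bessel_red_pos nu a) as HJ. pose proof (bessel_red_lower nu a) as HJl.
  pose proof (bessel_red_pos nu b) as HJb.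
  set (h := besselI (S nu) x / besselI nu x).
  pose proof (besselI_ratio_bounds nu x ltac:(lra)) as Hh. fold h in Hh.
  (* This identifies the linear coefficient: the logarithmic derivative of J_nu at a is 2 h. *)
  assert (Eh : a * bessel_red (S nu) a = h * bessel_red nu a).
  { unfold h. rewrite !besselI_red. fold a. rewrite <- tech_pow_Rmult. field.
    split; [lra|]. apply pow_nonzero. lra. }
  set (w := bessel_red nu b / bessel_red nu a - 1).
  assert (Ew : w - x * r * h
    = (bessel_red nu b - bessel_red nu a - 2 * a * bessel_red (S nu) a * (b - a)) / bessel_red nu a).
  { unfold w. replace (2 * a * bessel_red (S nu) a * (b - a))
      with (2 * (a * bessel_red (S nu) a) * (b - a)) by ring.
    rewrite Eh. unfold b. replace x with (2 * a) by (unfold a; field). field. lra. }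
  assert (Hw : Rabs (w - x * r * h) <= bessel_const * (x * r) ^ 2 / 4).
  { rewrite Ew. unfold Rdiv at 1. rewrite Rabs_mult, (Rabs_pos_eq (/ _))
      by (apply Rlt_le, Rinv_0_lt_compat, HJ).
    apply Rle_div_l; [exact HJ|].
    eapply Rle_trans; [exact HT|].
    replace (b - a) with (x * r / 2) by (unfold b, a; field).
    replace (bessel_const * / INR (fact nu) * (x * r / 2) ^ 2)
      with (bessel_const * (x * r) ^ 2 / 4 * / INR (fact nu)) by (field; apply INR_fact_neq_0).
    apply Rmult_le_compat_l; [|exact HJl].
    pose proof (pow2_ge_0 (x * r)). nra. }
  assert (Hwr : Rabs w <= x * Rabs r).
  { replace w with ((w - x * r * h) + x * r * h) by ring.
    eapply Rle_trans; [apply Rabs_triang|].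
    rewrite (Rabs_mult (x * r) h), (Rabs_mult x r), (Rabs_pos_eq x), (Rabs_pos_eq h) by lra.
    rewrite <- (pow2_abs (x * r)), Rabs_mult, (Rabs_pos_eq x) in Hw by lra.
    assert (x * Rabs r * h <= x * Rabs r * (1 / 2)) by (apply Rmult_le_compat_l; nra).
    assert (bessel_const * (x * Rabs r) ^ 2 / 4 <= x * Rabs r * (1 / 4)).
    { replace (bessel_const * (x * Rabs r) ^ 2 / 4)
        with (x * Rabs r * (x * (bessel_const * Rabs r) / 4)) by field.
      apply Rmult_le_compat_l; nra. }
    nra. }
  assert (Hw2 : Rabs w <= 1 / 2) by nra.
  pose proof (ln_taylor1 w Hw2) as Hln.
  assert (Hw3 : w ^ 2 <= (x * r) ^ 2).
  { rewrite <- (pow2_abs w), <- (pow2_abs (x * r)), Rabs_mult, (Rabs_pos_eq x) by lra.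
    apply pow_incr. split; [apply Rabs_pos|exact Hwr]. }
  assert (El : ln (besselI nu (x * (1 + r)) / besselI nu x) = INR nu * ln (1 + r) + ln (1 + w)).
  { rewrite !besselI_red. replace (x * (1 + r) / 2) with b by (unfold b, a; field).
    fold a. unfold b at 1. rewrite Rpow_mult_distr.
    replace (a ^ nu * (1 + r) ^ nu * bessel_red nu b / (a ^ nu * bessel_red nu a))
      with ((1 + r) ^ nu * (1 + w)).
    2: { unfold w. field. split; [lra|]. apply pow_nonzero. lra. }
    rewrite ln_mult, ln_pow; [reflexivity|lra|apply pow_lt; lra|].
    replace (1 + w) with (bessel_red nu b / bessel_red nu a) by (unfold w; ring).
    now apply Rdiv_lt_0_compat. }
  rewrite El.
  replace (INR nu * ln (1 + r) + ln (1 + w) - (INR nu * ln (1 + r) + x * r * h))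
    with ((ln (1 + w) - w) + (w - x * r * h)) by ring.
  eapply Rle_trans; [apply Rabs_triang|].
  pose proof (pow2_ge_0 (x * r)). nra.
Qed.

(** * The Gaussian distribution function *)

Lemma exp_le_compat (x y : R) : x <= y -> exp x <= exp y.
Proof. intros [H| ->]; [apply Rlt_le; now apply exp_increasing|lra]. Qed.

Lemma gauss_pos (x : R) : 0 < gauss x.
Proof. apply exp_pos. Qed.

Lemma gauss_le_1 (x : R) : gauss x <= 1.
Proof.
  unfold gauss. rewrite <- exp_0. apply exp_le_compat. nra.
Qed.

Lemma gauss_continuous (x : R) : continuous gauss x.
Proof. apply continuity_pt_filterlim, gauss_cont. Qed.

Lemma gauss_ex_RInt (a b : R) : ex_RInt gauss a b.
Proof. apply (ex_RInt_continuous gauss). intros; apply gauss_continuous. Qed.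

Lemma gauss_derive (x : R) : is_derive gauss x (- x * gauss x).
Proof. unfold gauss. auto_derive; [exact I|]. unfold Rdiv. field. Qed.

Definition gauss_prim (x : R) : R := RInt gauss 0 x.

Lemma gauss_prim_derive (x : R) : is_derive gauss_prim x (gauss x).
Proof.
  apply (is_derive_RInt gauss gauss_prim 0 x); [|apply gauss_continuous].
  exists (mkposreal 1 Rlt_0_1). intros y _. apply (@RInt_correct R_CompleteNormedModule).
  apply gauss_ex_RInt.
Qed.

Lemma Phi_RInt (x : R) : Phi x = / 2 + / sqrt (2 * PI) * gauss_prim x.
Proof.
  unfold Phi, gauss_prim. destruct (Rle_dec 0 x) as [H|H].
  - now rewrite <- RInt_Reals.
  - rewrite <- RInt_Reals, <- (opp_RInt_swap gauss 0 x) by apply gauss_ex_RInt.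
    unfold opp; simpl. ring.
Qed.

Lemma is_derive_plus_R (f g : R -> R) (x df dg : R) :
  is_derive f x df -> is_derive g x dg -> is_derive (fun t => f t + g t) x (df + dg).
Proof. exact (is_derive_plus f g x df dg). Qed.

(** The integrand of the classical evaluation of the Gaussian integral by differentiation under the
    integral sign. *)
Definition gauss_aux (x t : R) : R := exp (- (x * x) * (1 + t * t) / 2) / (1 + t * t).

Definition gauss_aux_dx (x t : R) : R := - x * gauss x * gauss (x * t).

Lemma gauss_aux_derive (x t : R) :
  is_derive (fun u => gauss_aux u t) x (gauss_aux_dx x t).
Proof.
  unfold gauss_aux, gauss_aux_dx, gauss. assert (0 <= t * t) by nra.
  auto_derive; [lra|].
  replace (- x * exp (- (x * x) / 2) * exp (- (x * t * (x * t)) / 2))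
    with (- x * (exp (- (x * x) / 2) * exp (- (x * t * (x * t)) / 2))) by ring.
  rewrite <- exp_plus.
  replace (- (x * x) / 2 + - (x * t * (x * t)) / 2) with (- (x * x) * (1 + t * t) / 2) by field.
  unfold Rdiv. field. lra.
Qed.

Lemma gauss_aux_dx_continuity (x t : R) : continuity_2d_pt gauss_aux_dx x t.
Proof.
  unfold gauss_aux_dx. apply continuity_2d_pt_mult.
  - apply continuity_2d_pt_mult.
    + apply continuity_2d_pt_opp, continuity_2d_pt_id1.
    + apply (continuity_1d_2d_pt_comp gauss (fun u _ => u));
        [apply gauss_cont|apply continuity_2d_pt_id1].
  - apply (continuity_1d_2d_pt_comp gauss (fun u v => u * v)); [apply gauss_cont|].
    apply continuity_2d_pt_mult; [apply continuity_2d_pt_id1|apply continuity_2d_pt_id2].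
Qed.

Lemma gauss_aux_ex_RInt (x : R) : ex_RInt (gauss_aux x) 0 1.
Proof.
  apply (ex_RInt_continuous (gauss_aux x)). intros t _.
  apply (ex_derive_continuous (gauss_aux x)). unfold gauss_aux. auto_derive.
  assert (0 <= t * t) by nra. lra.
Qed.

Lemma gauss_aux_RInt_derive (x : R) :
  is_derive (fun u => RInt (gauss_aux u) 0 1) x (- gauss x * gauss_prim x).
Proof.
  assert (E : - gauss x * gauss_prim x = RInt (fun t => Derive (fun u => gauss_aux u t) x) 0 1).
  (* The substitution u = x t turns the integral of [x * gauss (x * t)] over [0, 1] into
     [gauss_prim x]; the added 0 matches the form of the affine change of variables. *)
  { rewrite (RInt_ext (fun t => Derive (fun u => gauss_aux u t) x)
      (fun t => scal (- gauss x) (scal x (gauss (x * t + 0))))).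
    - symmetry. etransitivity; [apply (RInt_scal (fun t => scal x (gauss (x * t + 0))) 0 1)|].
      + apply (ex_RInt_comp_lin gauss), gauss_ex_RInt.
      + transitivity (- gauss x * RInt gauss (x * 0 + 0) (x * 1 + 0)).
        * apply (f_equal (Rmult (- gauss x))), (RInt_comp_lin gauss), gauss_ex_RInt.
        * now rewrite Rmult_0_r, !Rplus_0_r, Rmult_1_r.
    - intros t _. etransitivity; [apply is_derive_unique, gauss_aux_derive|].
      unfold gauss_aux_dx, scal; simpl. unfold mult; simpl. rewrite Rplus_0_r. ring. }
  rewrite E.
  apply (is_derive_RInt_param gauss_aux 0 1 x).
  - exists (mkposreal 1 Rlt_0_1). intros y _ t _. eexists. apply gauss_aux_derive.
  - intros t _. apply continuity_2d_pt_ext with gauss_aux_dx; [|apply gauss_aux_dx_continuity].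
    intros u v. symmetry. apply is_derive_unique, gauss_aux_derive.
  - exists (mkposreal 1 Rlt_0_1). intros y _. apply gauss_aux_ex_RInt.
Qed.

(* The derivative of the left-hand side vanishes; at [x = 0] it is [2 * atan 1]. *)
Lemma gauss_prim_sq (x : R) : gauss_prim x ^ 2 + 2 * RInt (gauss_aux x) 0 1 = PI / 2.
Proof.
  set (F := fun x => gauss_prim x ^ 2 + 2 * RInt (gauss_aux x) 0 1).
  assert (HF : forall t, is_derive F t 0).
  { intros t. unfold F.
    assert (E : 2 * gauss t * gauss_prim t + 2 * (- gauss t * gauss_prim t) = 0) by ring.
    refine (eq_ind _ (is_derive _ t) _ _ E). clear E.
    apply (is_derive_plus_R (fun x => gauss_prim x ^ 2) (fun x => 2 * RInt (gauss_aux x) 0 1)).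
    - replace (2 * gauss t * gauss_prim t) with (INR 2 * gauss t * gauss_prim t ^ pred 2)
        by (simpl; ring).
      apply is_derive_pow, gauss_prim_derive.
    - apply (is_derive_scal (fun u => RInt (gauss_aux u) 0 1)), gauss_aux_RInt_derive. }
  assert (E : F x = F 0).
  { pose proof (mvt_bound F (fun _ => 0) x 0) as M.
    assert (Rabs (F x - F 0) <= 0 * Rabs x).
    { apply M; intros; [apply HF|rewrite Rabs_R0; lra]. }
    rewrite Rmult_0_l in H. pose proof (Rabs_pos (F x - F 0)).
    destruct (Req_dec (F x - F 0) 0) as [Z|Z]; [lra|].
    apply Rabs_pos_lt in Z. lra. }
  fold (F x). rewrite E. unfold F, gauss_prim. rewrite RInt_point.
  assert (H : is_RInt (gauss_aux 0) 0 1 (atan 1 - atan 0)).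
  { apply (is_RInt_derive atan (gauss_aux 0)).
    - intros t _. replace (gauss_aux 0 t) with (/ (1 + t ^ 2)).
      + apply is_derive_Reals. apply derivable_pt_lim_atan.
      + unfold gauss_aux. replace (- (0 * 0) * (1 + t * t) / 2) with 0 by field.
        rewrite exp_0. field. nra.
    - intros t _. apply (ex_derive_continuous (gauss_aux 0)). unfold gauss_aux. auto_derive.
      assert (0 <= t * t) by nra. lra. }
  rewrite (is_RInt_unique _ _ _ _ H), atan_1, atan_0. unfold zero; simpl. field.
Qed.

Lemma gauss_aux_RInt_bounds (x : R) : 0 <= RInt (gauss_aux x) 0 1 <= gauss x.
Proof.
  assert (H : forall t, 0 <= gauss_aux x t <= gauss x).
  { intros t. unfold gauss_aux, gauss. assert (0 <= t * t) by nra.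
    pose proof (exp_pos (- (x * x) * (1 + t * t) / 2)).
    split.
    - apply Rlt_le, Rdiv_lt_0_compat; lra.
    - apply Rle_div_l; [lra|].
      assert (exp (- (x * x) * (1 + t * t) / 2) <= exp (- (x * x) / 2)) by (apply exp_le_compat; nra).
      pose proof (exp_pos (- (x * x) / 2)). nra. }
  split.
  - apply RInt_ge_0; [lra|apply gauss_aux_ex_RInt|]. intros t _. apply H.
  - replace (gauss x) with (RInt (fun _ => gauss x) 0 1).
    + apply RInt_le; [lra|apply gauss_aux_ex_RInt|apply ex_RInt_const|].
      intros t _. apply H.
    + rewrite RInt_const. unfold scal; simpl. unfold mult; simpl. ring.
Qed.

Lemma sqrt_2PI_ge_1 : 1 <= sqrt (2 * PI).
Proof.
  rewrite <- sqrt_1. apply sqrt_le_1_alt. pose proof PI2_1. lra.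
Qed.

Lemma Phi_derive (x : R) : is_derive Phi x (/ sqrt (2 * PI) * gauss x).
Proof.
  apply is_derive_ext with (fun x => / 2 + / sqrt (2 * PI) * gauss_prim x).
  - intros t. symmetry. apply Phi_RInt.
  - replace (/ sqrt (2 * PI) * gauss x) with (0 + / sqrt (2 * PI) * gauss x) by ring.
    apply (is_derive_plus_R (fun _ => / 2)); [apply (is_derive_const (/ 2))|].
    apply (is_derive_scal gauss_prim), gauss_prim_derive.
Qed.

Lemma gauss_prim_opp (x : R) : gauss_prim (- x) = - gauss_prim x.
Proof.
  pose proof (mvt_bound (fun t => gauss_prim (- t) + gauss_prim t) (fun _ => 0) x 0) as M.
  assert (H : Rabs ((gauss_prim (- x) + gauss_prim x) - (gauss_prim (- 0) + gauss_prim 0)) <= 0 * Rabs x).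
  { apply M; intros t _; [|rewrite Rabs_R0; lra].
    assert (E : -1 * gauss (- t) + gauss t = 0).
    2: refine (eq_ind _ (is_derive _ t) _ _ E).
    2: apply (is_derive_plus_R (fun t => gauss_prim (- t)) gauss_prim); [|apply gauss_prim_derive].
    2: apply (is_derive_comp gauss_prim Ropp); [apply gauss_prim_derive|].
    2: auto_derive; [exact I|ring].
    unfold gauss. replace (- t * - t) with (t * t) by ring. ring. }
  assert (E0 : gauss_prim 0 = 0) by apply (RInt_point 0 gauss).
  rewrite Ropp_0, E0, Rmult_0_l in H.
  pose proof (Rle_abs (gauss_prim (- x) + gauss_prim x - (0 + 0))) as A1.
  pose proof (Rle_abs (- (gauss_prim (- x) + gauss_prim x - (0 + 0)))) as A2.
  rewrite Rabs_Ropp in A2. lra.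
Qed.

Lemma gauss_prim_nonneg (x : R) : 0 <= x -> 0 <= gauss_prim x.
Proof.
  intros H. apply RInt_ge_0; [exact H|apply gauss_ex_RInt|].
  intros t _. apply Rlt_le, gauss_pos.
Qed.

(** Read off [gauss_prim_sq] with the correction term between 0 and [2 * gauss x]. This gives the
    normalisation and the tail at once, with no limit at infinity. *)
Lemma gauss_prim_bounds (x : R) : 0 <= x ->
  sqrt (PI / 2) * (1 - gauss x * 2) <= gauss_prim x <= sqrt (PI / 2).
Proof.
  intros H. pose proof (gauss_prim_sq x) as E. pose proof (gauss_aux_RInt_bounds x) as B.
  pose proof (gauss_prim_nonneg x H) as P. pose proof (gauss_pos x) as G.
  set (s := sqrt (PI / 2)). assert (Hs : s * s = PI / 2) by (apply sqrt_sqrt; pose proof PI2_1; lra).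
  assert (s0 : 1 <= s).
  { unfold s. rewrite <- sqrt_1. apply sqrt_le_1_alt. pose proof PI2_1. lra. }
  split; [|nra].
  destruct (Rle_dec (s * (1 - gauss x * 2)) 0) as [N|N]; [lra|].
  (* With g = [gauss x] < 1 / 2 and PI / 2 >= 1 one has (1 - 2 g)^2 PI / 2 <= PI / 2 - 2 g, so the
     squares can be compared. *)
  apply Rnot_le_lt in N. assert (H2 : gauss x * 2 < 1) by nra.
  apply Rsqr_incr_0_var; [|exact P]. unfold Rsqr. set (g := gauss x) in *.
  assert (H3 : 0 <= g * (1 / 2 - g)) by (apply Rmult_le_pos; lra).
  assert (H4 : 0 <= g * (1 / 2 - g) * (s * s - 1)) by (apply Rmult_le_pos; nra).
  nra.
Qed.

Lemma Phi_opp (x : R) : Phi (- x) = 1 - Phi x.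
Proof. rewrite !Phi_RInt, gauss_prim_opp. field. apply Rgt_not_eq. pose proof sqrt_2PI_ge_1. lra. Qed.

Lemma sqrt_2PI_half : / sqrt (2 * PI) * sqrt (PI / 2) = / 2.
Proof.
  replace (2 * PI) with (2 ^ 2 * (PI / 2)) by field.
  pose proof PI2_1.
  rewrite sqrt_mult_alt, sqrt_pow2 by lra.
  assert (0 < sqrt (PI / 2)) by (apply sqrt_lt_R0; lra). field. lra.
Qed.

Lemma Phi_tail (x : R) : 0 <= x -> 1 - gauss x <= Phi x <= 1.
Proof.
  intros H. rewrite Phi_RInt. pose proof (gauss_prim_bounds x H) as B.
  pose proof sqrt_2PI_half as E. pose proof sqrt_2PI_ge_1 as S.
  set (c := / sqrt (2 * PI)) in *. assert (0 < c) by (apply Rinv_0_lt_compat; lra).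
  split; [|nra].
  assert (c * (sqrt (PI / 2) * (1 - gauss x * 2)) <= c * gauss_prim x)
    by (apply Rmult_le_compat_l; lra).
  rewrite <- Rmult_assoc, E in H1. lra.
Qed.

Lemma Phi_bounds (x : R) : 0 <= Phi x <= 1.
Proof.
  destruct (Rle_dec 0 x) as [H|H].
  - pose proof (Phi_tail x H). pose proof (gauss_le_1 x). lra.
  - pose proof (Phi_tail (- x) ltac:(lra)) as B. pose proof (gauss_le_1 (- x)).
    rewrite Phi_opp in B. lra.
Qed.

Lemma Phi_lipschitz (x y : R) : Rabs (Phi y - Phi x) <= Rabs (y - x).
Proof.
  pose proof (mvt_bound (fun t => Phi (x + t)) (fun t => 1 * (/ sqrt (2 * PI) * gauss (x + t)))
    (y - x) 1) as M.
  cbv beta in M. rewrite Rplus_0_r in M. replace (x + (y - x)) with y in M by ring.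
  rewrite <- (Rmult_1_l (Rabs (y - x))). apply M.
  - intros t _. apply (is_derive_comp Phi (fun t => x + t)); [apply Phi_derive|].
    auto_derive; [exact I|ring].
  - intros t _. pose proof (gauss_pos (x + t)). pose proof (gauss_le_1 (x + t)).
    pose proof sqrt_2PI_ge_1 as S.
    assert (0 < / sqrt (2 * PI) <= 1).
    { split; [apply Rinv_0_lt_compat; lra|]. rewrite <- Rinv_1. apply Rinv_le_contravar; lra. }
    rewrite Rabs_pos_eq; nra.
Qed.

Lemma Phi_mono (x y : R) : x <= y -> Phi x <= Phi y.
Proof.
  intros [H| ->]; [|lra].
  destruct (MVT_gen Phi x y (fun t => / sqrt (2 * PI) * gauss t)) as [c [_ E]].
  - intros; apply Phi_derive.
  - intros. apply continuity_pt_filterlim, (ex_derive_continuous Phi).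
    eexists; apply Phi_derive.
  - pose proof (gauss_pos c). pose proof sqrt_2PI_ge_1 as S.
    assert (0 < / sqrt (2 * PI)) by (apply Rinv_0_lt_compat; lra).
    assert (0 <= / sqrt (2 * PI) * gauss c * (y - x)) by (apply Rmult_le_pos; nra). lra.
Qed.

(** The reciprocal of [gauss x] is the square of exp (x^2 / 4), which is at least 1 + x^2 / 4. *)
Lemma gauss_poly_bound (x : R) : (1 + x ^ 2 / 4) ^ 2 * gauss x <= 1.
Proof.
  unfold gauss. pose proof (exp_ineq1_le (x * x / 4)) as H.
  pose proof (exp_pos (x * x / 4)) as P.
  assert (E : exp (x * x / 4) * exp (x * x / 4) * exp (- (x * x) / 2) = 1).
  { rewrite <- !exp_plus, <- exp_0. f_equal. field. }
  rewrite <- E. apply Rmult_le_compat_r; [apply Rlt_le, exp_pos|].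
  assert (0 <= x * x) by nra. simpl. nra.
Qed.

(** * One replacement step *)

Lemma gauss_mul_bounds (w : R) :
  Rabs w * gauss w <= 1 /\ w ^ 2 * gauss w <= 2 /\ Rabs w ^ 3 * gauss w <= 4.
Proof.
  pose proof (gauss_poly_bound w) as H. pose proof (gauss_pos w) as G.
  pose proof (Rabs_pos w) as P. rewrite <- (pow2_abs w) in *. set (v := Rabs w) in *.
  set (g := gauss w) in *. clearbody v g.
  assert (H1 : v <= 1 + v ^ 2 / 4) by (pose proof (pow2_ge_0 (v / 2 - 1)); lra).
  assert (Q : 1 <= 1 + v ^ 2 / 4) by (pose proof (pow2_ge_0 v); lra).
  set (r := 1 + v ^ 2 / 4) in *.
  assert (E2 : v ^ 2 = 4 * (r - 1)) by (unfold r; field). clearbody r.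
  assert (H2 : r * g <= 1) by (assert (r * g <= r ^ 2 * g) by (apply Rmult_le_compat_r; nra); lra).
  assert (H3 : v * v ^ 2 <= 4 * r ^ 2) by (rewrite E2; assert (v * (r - 1) <= r * r) by nra; lra).
  repeat split.
  - apply Rle_trans with (r * g); [apply Rmult_le_compat_r; lra|exact H2].
  - rewrite E2. assert (2 * (r - 1) <= r ^ 2) by nra.
    assert (2 * (r - 1) * g <= r ^ 2 * g) by (apply Rmult_le_compat_r; lra). lra.
  - replace (v ^ 3) with (v * v ^ 2) by ring.
    assert (v * v ^ 2 * g <= 4 * r ^ 2 * g) by (apply Rmult_le_compat_r; lra). lra.
Qed.

Definition dens (x : R) : R := / sqrt (2 * PI) * gauss x.

Lemma dens_le_gauss (x : R) : 0 <= dens x <= gauss x.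
Proof.
  unfold dens. pose proof (gauss_pos x). pose proof sqrt_2PI_ge_1 as S.
  assert (0 < / sqrt (2 * PI) <= 1).
  { split; [apply Rinv_0_lt_compat; lra|]. rewrite <- Rinv_1. apply Rinv_le_contravar; lra. }
  nra.
Qed.

Lemma dens_derive (x : R) : is_derive dens x (- x * dens x).
Proof.
  replace (- x * dens x) with (/ sqrt (2 * PI) * (- x * gauss x)) by (unfold dens; ring).
  apply (is_derive_scal gauss), gauss_derive.
Qed.

Lemma is_derive_shift (f : R -> R) (x t d : R) :
  is_derive f (x + t) d -> is_derive (fun t => f (x + t)) t d.
Proof.
  intros H. rewrite <- (Rmult_1_l d).
  apply (is_derive_comp f (fun t => x + t)); [exact H|]. auto_derive; [exact I|ring].
Qed.

Lemma Phi_taylor (x h : R) :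
  Rabs (Phi (x + h) - Phi x - h * dens x - h ^ 2 / 2 * (- x * dens x)) <= 3 * Rabs h ^ 3.
Proof.
  pose proof (taylor2_bound (fun t => Phi (x + t)) (fun t => dens (x + t))
    (fun t => - (x + t) * dens (x + t))
    (fun t => ((x + t) ^ 2 - 1) * dens (x + t)) h 3) as T.
  cbv beta in T. rewrite !Rplus_0_r in T. apply T; intros t.
  - apply is_derive_shift, Phi_derive.
  - apply is_derive_shift, dens_derive.
  - apply (is_derive_shift (fun w => - w * dens w)).
    auto_derive; [eexists; apply dens_derive|].
    change (Derive (fun w => dens w)) with (Derive dens).
    rewrite (is_derive_unique _ _ _ (dens_derive (x + t))). ring.
  (* The third derivative of [Phi] is (w^2 - 1) [dens w], at most 2 + 1 in absolute value. *)
  - destruct (gauss_mul_bounds (x + t)) as [_ [H _]].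
    pose proof (dens_le_gauss (x + t)). pose proof (gauss_le_1 (x + t)).
    pose proof (pow2_ge_0 (x + t)). apply Rabs_le. nra.
Qed.

Lemma scaled_derive (x t : R) : 0 <= t ->
  is_derive (fun t => x / sqrt (1 + t)) t (- (x / sqrt (1 + t)) * / (2 * (1 + t))).
Proof.
  intros Ht. pose proof (sqrt_sqrt (1 + t) ltac:(lra)) as E.
  assert (P : 0 < sqrt (1 + t)) by (apply sqrt_lt_R0; lra).
  auto_derive; [split; [lra|split; [lra|exact I]]|].
  set (s := sqrt (1 + t)) in *. rewrite <- E. field. lra.
Qed.

(* First order expansion in time, i.e. in the variance [1 + e]; the linear
   coefficient is half the second space derivative: the heat equation. *)
Lemma Phi_time_taylor (x e : R) : 0 <= e ->
  Rabs (Phi (x / sqrt (1 + e)) - Phi x - e * (- (1 / 2) * (x * dens x))) <= 2 * e ^ 2.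
Proof.
  intros He.
  set (w := fun t => x / sqrt (1 + t)).
  assert (w0 : w 0 = x) by (unfold w; rewrite Rplus_0_r, sqrt_1; field).
  assert (Hw : forall t, 0 <= t -> is_derive w t (- w t * / (2 * (1 + t))))
    by (intros t Ht; now apply scaled_derive).
  fold (w e). clearbody w.
  pose proof (taylor1_bound (fun t => Phi (w t))
    (fun t => - (1 / 2) * (/ (1 + t) * (w t * dens (w t))))
    (fun t => / (1 + t) ^ 2 * (1 / 2 * (w t * dens (w t))
               + 1 / 4 * ((1 - w t ^ 2) * w t * dens (w t)))) e 2) as T.
  cbv beta in T.
  rewrite w0, Rplus_0_r, Rinv_1, Rmult_1_l in T. apply T; clear T;
    intros t; rewrite Rmin_left, Rmax_right by exact He; intros Ht.
  - replace (- (1 / 2) * (/ (1 + t) * (w t * dens (w t))))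
      with (- w t * / (2 * (1 + t)) * dens (w t)) by (field; lra).
    apply (is_derive_comp Phi w); [apply Phi_derive|]. apply Hw; lra.
  - specialize (Hw t ltac:(lra)).
    auto_derive.
    + repeat split; [lra|eexists; exact Hw|eexists; apply dens_derive|eexists; exact Hw].
    + change (Derive (fun w => dens w)) with (Derive dens).
      change (Derive (fun t => w t)) with (Derive w).
      rewrite (is_derive_unique w _ _ Hw).
      rewrite (is_derive_unique _ _ _ (dens_derive (w t))). field. lra.
  (* The factor 1 / (1 + t)^2 is at most 1, and the rest at most 1/2 * 1 + 1/4 * (1 + 4) <= 2. *)
  - destruct (gauss_mul_bounds (w t)) as [H1 [_ H3]].
    pose proof (dens_le_gauss (w t)) as D. set (v := w t) in *.
    pose proof (Rabs_pos v) as P.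
    assert (K1 : Rabs (v * dens v) <= 1).
    { rewrite Rabs_mult, (Rabs_pos_eq (dens v)) by lra. nra. }
    assert (K3 : Rabs (v ^ 3 * dens v) <= 4).
    { rewrite Rabs_mult, <- RPow_abs, (Rabs_pos_eq (dens v)) by lra.
      assert (0 <= Rabs v ^ 3) by (apply pow_le; lra). nra. }
    replace ((1 - v ^ 2) * v * dens v) with (v * dens v - v ^ 3 * dens v) by ring.
    rewrite Rabs_mult, Rabs_pos_eq by (apply Rlt_le, Rinv_0_lt_compat, pow_lt; lra).
    assert (/ (1 + t) ^ 2 <= 1) by (rewrite <- Rinv_1; apply Rinv_le_contravar; nra).
    assert (0 < / (1 + t) ^ 2) by (apply Rinv_0_lt_compat, pow_lt; lra).
    apply Rabs_le_between in K1, K3.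
    assert (Rabs (1 / 2 * (v * dens v) + 1 / 4 * (v * dens v - v ^ 3 * dens v)) <= 2)
      by (apply Rabs_le; lra).
    pose proof (Rabs_pos (1 / 2 * (v * dens v) + 1 / 4 * (v * dens v - v ^ 3 * dens v))).
    nra.
Qed.

(** By the heat equation the time expansion in d and the space expansion in X share the coefficient
    u2, so the second order part is u2 (X^2 - d), which averages out when X has variance d. The
    coefficients are chosen before X and d so that they can be taken out of an expectation, and C
    depends on eta only so that it serves all replacement steps. *)
Lemma Phi_lindeberg_step (eta : R) : 0 < eta ->
  exists C, 0 <= C /\ forall s y, eta <= s -> exists u1 u2,
    Rabs u1 <= C /\ Rabs u2 <= C /\
    forall X d, 0 <= d ->
      Rabs (Phi ((y - X) / sqrt s) - Phi (y / sqrt (s + d)) - u1 * X - u2 * (X ^ 2 - d))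
      <= C * (Rabs X ^ 3 + d ^ 2).
Proof.
  intros Heta. set (q0 := / sqrt eta).
  assert (S0 : 0 < sqrt eta) by now apply sqrt_lt_R0.
  assert (Q0 : 0 < q0) by now apply Rinv_0_lt_compat.
  (* Scaling by q = 1 / sqrt s <= q0 produces powers of q from 1 to 4, all below (1 + q0)^4; the 3
     is the constant of [Phi_taylor]. *)
  exists (3 * (1 + q0) ^ 4). split; [apply Rmult_le_pos; [lra|apply pow_le; lra]|].
  intros s y Hs. set (q := / sqrt s).
  assert (Ss : 0 < sqrt s) by (apply sqrt_lt_R0; lra).
  assert (Q1 : 0 < q) by now apply Rinv_0_lt_compat.
  assert (Qle : q <= q0) by (apply Rinv_le_contravar; [exact S0|now apply sqrt_le_1_alt]).
  assert (Eq : q ^ 2 = / s).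
  { unfold q. rewrite pow_inv. f_equal. rewrite pow2_sqrt; lra. }
  set (z := y / sqrt s).
  assert (C1 : q0 <= (1 + q0) ^ 4 /\ q0 ^ 2 <= (1 + q0) ^ 4 /\ q0 ^ 3 <= (1 + q0) ^ 4
               /\ q0 ^ 4 <= (1 + q0) ^ 4).
  { assert (0 < q0 ^ 2 /\ 0 < q0 ^ 3 /\ 0 < q0 ^ 4) by (repeat split; now apply pow_lt).
    replace ((1 + q0) ^ 4) with (1 + 4 * q0 + 6 * q0 ^ 2 + 4 * q0 ^ 3 + q0 ^ 4) by ring. lra. }
  destruct C1 as [C1 [C2 [C3 C4]]]. set (M := (1 + q0) ^ 4) in *.
  destruct (gauss_mul_bounds z) as [G1 _]. pose proof (dens_le_gauss z) as G0.
  pose proof (gauss_le_1 z) as G2. pose proof (Rabs_pos z) as Pz.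
  assert (Pq : q ^ 2 <= q0 ^ 2 /\ q ^ 3 <= q0 ^ 3 /\ q ^ 4 <= q0 ^ 4)
    by (repeat split; apply pow_incr; lra).
  destruct Pq as [P2 [P3 P4]].
  exists (- q * dens z), (- (q ^ 2 / 2) * (z * dens z)). split; [|split].
  - rewrite Rabs_mult, Rabs_Ropp, !Rabs_pos_eq by lra. nra.
  - rewrite Rabs_mult, Rabs_Ropp, (Rabs_pos_eq (q ^ 2 / 2)) by nra.
    rewrite Rabs_mult, (Rabs_pos_eq (dens z)) by lra.
    assert (0 <= Rabs z * dens z <= 1) by nra. nra.
  - intros X d Hd.
    pose proof (Phi_taylor z (- X * q)) as T1.
    assert (He : 0 <= d * q ^ 2) by (apply Rmult_le_pos; [exact Hd|apply pow2_ge_0]).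
    pose proof (Phi_time_taylor z (d * q ^ 2) He) as T2.
    replace ((y - X) / sqrt s) with (z + - X * q) by (unfold z, q, Rdiv; ring).
    assert (Ez : y / sqrt (s + d) = z / sqrt (1 + d * q ^ 2)).
    { unfold z. rewrite Eq. replace (s + d) with (s * (1 + d * / s)) by (field; lra).
      rewrite sqrt_mult_alt by lra. rewrite Eq in He.
      assert (0 < sqrt (1 + d * / s)) by (apply sqrt_lt_R0; lra). field. lra. }
    rewrite Ez. set (A := Phi (z + - X * q)) in *. set (B := Phi (z / _)) in *.
    replace (A - B - - q * dens z * X - - (q ^ 2 / 2) * (z * dens z) * (X ^ 2 - d))
      with ((A - Phi z - - X * q * dens z - (- X * q) ^ 2 / 2 * (- z * dens z))
            - (B - Phi z - d * q ^ 2 * (- (1 / 2) * (z * dens z)))) by field.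
    eapply Rle_trans; [apply Rabs_triang|]. rewrite Rabs_Ropp.
    replace (Rabs (- X * q) ^ 3) with (Rabs X ^ 3 * q ^ 3) in T1
      by (rewrite Rabs_mult, Rabs_Ropp, (Rabs_pos_eq q) by lra; ring).
    replace ((d * q ^ 2) ^ 2) with (d ^ 2 * q ^ 4) in T2 by ring.
    assert (0 <= Rabs X ^ 3) by (apply pow_le, Rabs_pos).
    assert (Rabs X ^ 3 * q ^ 3 <= Rabs X ^ 3 * M) by (apply Rmult_le_compat_l; lra).
    assert (d ^ 2 * q ^ 4 <= d ^ 2 * M) by (apply Rmult_le_compat_l; [apply pow2_ge_0|lra]).
    pose proof (pow2_ge_0 d).
    assert (0 <= d ^ 2 * M) by (apply Rmult_le_pos; [assumption|apply pow_le; lra]).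
    lra.
Qed.

(** * Chebyshev's inequality and Lindeberg's argument *)

Lemma boxsum_S (n K : nat) (F : list Z -> R) :
  boxsum (S n) K F = sym_sum K (fun z => boxsum n K (fun l => F (z :: l))).
Proof. reflexivity. Qed.

Lemma boxsum_le (n K : nat) (F G : list Z -> R) :
  (forall l, length l = n -> F l <= G l) -> boxsum n K F <= boxsum n K G.
Proof.
  revert F G. induction n as [|n IH]; intros F G H; [now apply H|].
  rewrite !boxsum_S. apply sym_sum_le. intros z _. apply IH.
  intros l Hl. apply H. simpl. now rewrite Hl.
Qed.

Lemma boxsum_ext (n K : nat) (F G : list Z -> R) :
  (forall l, length l = n -> F l = G l) -> boxsum n K F = boxsum n K G.
Proof.
  intros H. apply Rle_antisym; apply boxsum_le; intros l Hl; rewrite (H l Hl); apply Rle_refl.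
Qed.

Lemma boxsum_scal (n K : nat) (c : R) (F : list Z -> R) :
  boxsum n K (fun l => c * F l) = c * boxsum n K F.
Proof.
  revert F. induction n as [|n IH]; intros F; [reflexivity|].
  rewrite !boxsum_S, <- sym_sum_scal. apply sym_sum_ext. intros z _. apply IH.
Qed.

Lemma boxsum_plus (n K : nat) (F G : list Z -> R) :
  boxsum n K (fun l => F l + G l) = boxsum n K F + boxsum n K G.
Proof.
  revert F G. induction n as [|n IH]; intros F G; [reflexivity|].
  rewrite !boxsum_S, <- sym_sum_plus. apply sym_sum_ext. intros z _. apply IH.
Qed.

Definition sum_list (g : Z -> R) (l : list Z) : R := fold_right (fun z acc => g z + acc) 0 l.

Section Expectation.
Variable p : Z -> R.
Hypothesis p_nonneg : forall k, 0 <= p k.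
Hypothesis p_mass : is_mean p (fun _ => 1) 1.

(** Expectation restricted to the box and not renormalised: constants are multiplied by
    [trunc_mass K ^ n], at most 1 and tending to 1 as K grows. *)
Definition expect (K n : nat) (F : list Z -> R) : R :=
  boxsum n K (fun l => prodlist p l * F l).

Lemma prodlist_nonneg (l : list Z) : 0 <= prodlist p l.
Proof.
  induction l as [|z l IH]; simpl; [lra|]. now apply Rmult_le_pos.
Qed.

Lemma expect_0 (K : nat) (F : list Z -> R) : expect K 0 F = F nil.
Proof. unfold expect. simpl. ring. Qed.

Lemma expect_S (K n : nat) (F : list Z -> R) :
  expect K (S n) F = sym_sum K (fun z => p z * expect K n (fun l => F (z :: l))).
Proof.
  unfold expect. rewrite boxsum_S. apply sym_sum_ext. intros z _.
  rewrite <- boxsum_scal. apply boxsum_ext. intros l _. simpl. ring.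
Qed.

Lemma expect_le (K n : nat) (F G : list Z -> R) :
  (forall l, length l = n -> F l <= G l) -> expect K n F <= expect K n G.
Proof.
  intros H. apply boxsum_le. intros l Hl.
  apply Rmult_le_compat_l; [apply prodlist_nonneg|now apply H].
Qed.

Lemma expect_ext (K n : nat) (F G : list Z -> R) :
  (forall l, length l = n -> F l = G l) -> expect K n F = expect K n G.
Proof.
  intros H. apply boxsum_ext. intros l Hl. now rewrite (H l Hl).
Qed.

Lemma expect_scal (K n : nat) (c : R) (F : list Z -> R) :
  expect K n (fun l => c * F l) = c * expect K n F.
Proof.
  unfold expect. rewrite <- boxsum_scal. apply boxsum_ext. intros; ring.
Qed.

Lemma expect_plus (K n : nat) (F G : list Z -> R) :
  expect K n (fun l => F l + G l) = expect K n F + expect K n G.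
Proof.
  unfold expect. rewrite <- boxsum_plus. apply boxsum_ext. intros; ring.
Qed.

Definition trunc_mass (K : nat) : R := sym_sum K (fun k => p k * 1).

Lemma trunc_mass_bounds (K : nat) : 0 <= trunc_mass K <= 1.
Proof.
  split.
  - apply sym_sum_nonneg. intros z. rewrite Rmult_1_r. apply p_nonneg.
  - apply is_mean_sym_sum_le; [exact p_nonneg|intros; lra|exact p_mass].
Qed.

Lemma sym_sum_p_const (K : nat) (c : R) : sym_sum K (fun k => p k * c) = c * trunc_mass K.
Proof.
  unfold trunc_mass. rewrite <- sym_sum_scal. apply sym_sum_ext. intros; ring.
Qed.

Lemma expect_const (K n : nat) (c : R) : expect K n (fun _ => c) = c * trunc_mass K ^ n.
Proof.
  induction n as [|n IH]; [rewrite expect_0; simpl; ring|].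
  rewrite expect_S, IH, sym_sum_p_const. simpl. ring.
Qed.

Lemma expect_nonneg (K n : nat) (F : list Z -> R) :
  (forall l, 0 <= F l) -> 0 <= expect K n F.
Proof.
  intros H. rewrite <- (Rmult_0_l (trunc_mass K ^ n)), <- expect_const.
  now apply expect_le.
Qed.

Lemma expect_growing (K n : nat) (F : list Z -> R) :
  (forall l, 0 <= F l) -> expect K n F <= expect (S K) n F.
Proof.
  revert F. induction n as [|n IH]; intros F H; [rewrite !expect_0; lra|].
  rewrite !expect_S.
  apply Rle_trans with (sym_sum K (fun z => p z * expect (S K) n (fun l => F (z :: l)))).
  - apply sym_sum_le. intros z _. apply Rmult_le_compat_l; auto.
  - apply sym_sum_growing. intros z. apply Rmult_le_pos; [apply p_nonneg|].
    apply expect_nonneg. auto.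
Qed.

Lemma trunc_mass_pow_le (K n : nat) : 0 <= trunc_mass K ^ n <= 1.
Proof.
  pose proof (trunc_mass_bounds K) as H. split; [apply pow_le; lra|].
  rewrite <- (pow1 n). apply pow_incr. exact H.
Qed.

Lemma indic_bounds (P : Prop) : 0 <= indic P <= 1.
Proof. unfold indic. destruct (excluded_middle_informative P); lra. Qed.

(** The restricted expectations of an indicator increase with the box and stay below 1, so the
    chosen limit is a genuine one for every event. *)
Lemma prob_iid_cv (n : nat) (A : list Z -> Prop) :
  Un_cv (fun K => expect K n (fun l => indic (A l))) (prob_iid p n A).
Proof.
  destruct (growing_bounded_cv (fun K => expect K n (fun l => indic (A l))) 1) as [l [Hl _]].
  - intros K. apply expect_growing. intros l. apply indic_bounds.
  - intros K. apply Rle_trans with (expect K n (fun _ => 1)).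
    + apply expect_le. intros l _. apply indic_bounds.
    + rewrite expect_const, Rmult_1_l. apply trunc_mass_pow_le.
  - replace (prob_iid p n A) with l; [exact Hl|]. symmetry. now apply lim_seq_eq.
Qed.

Lemma expect_sum_list (K n : nat) (g : Z -> R) :
  Rabs (expect K n (sum_list g)) <= INR n * Rabs (sym_sum K (fun k => p k * g k)).
Proof.
  induction n as [|n IH].
  - rewrite expect_0. simpl. rewrite Rabs_R0. lra.
  - rewrite expect_S.
    rewrite (sym_sum_ext K _ (fun z => trunc_mass K ^ n * (p z * g z)
      + p z * expect K n (sum_list g))).
    2: { intros z _. simpl. rewrite expect_plus, expect_const. ring. }
    rewrite sym_sum_plus, sym_sum_scal, sym_sum_p_const, S_INR.
    eapply Rle_trans; [apply Rabs_triang|]. rewrite !Rabs_mult.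
    pose proof (trunc_mass_bounds K). pose proof (trunc_mass_pow_le K n).
    rewrite (Rabs_pos_eq (trunc_mass K ^ n)), (Rabs_pos_eq (trunc_mass K)) by lra.
    pose proof (Rabs_pos (sym_sum K (fun k => p k * g k))).
    pose proof (Rabs_pos (expect K n (sum_list g))). nra.
Qed.

(** The second term bounds the cross products. On a finite box the truncated mean may differ from
    its limit, so it is carried along. *)
Lemma expect_sum_list_sq (K n : nat) (g : Z -> R) :
  expect K n (fun l => sum_list g l ^ 2)
  <= INR n * sym_sum K (fun k => p k * g k ^ 2)
     + INR n ^ 2 * sym_sum K (fun k => p k * g k) ^ 2.
Proof.
  induction n as [|n IH].
  - rewrite expect_0. simpl. lra.
  - rewrite expect_S.
    set (m := expect K n (sum_list g)).
    set (v := expect K n (fun l => sum_list g l ^ 2)) in *.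
    rewrite (sym_sum_ext K _ (fun z => (trunc_mass K ^ n * (p z * g z ^ 2)
      + 2 * m * (p z * g z)) + p z * v)).
    2: { intros z _. simpl sum_list.
         rewrite (expect_ext K n _ (fun l => (g z ^ 2 + 2 * g z * sum_list g l) + sum_list g l ^ 2))
           by (intros; ring).
         rewrite !expect_plus, expect_const, expect_scal. fold m v. ring. }
    rewrite !sym_sum_plus, !sym_sum_scal, sym_sum_p_const, S_INR.
    pose proof (expect_sum_list K n g) as H1. fold m in H1.
    pose proof (trunc_mass_bounds K). pose proof (trunc_mass_pow_le K n).
    set (a := sym_sum K (fun k => p k * g k)) in *.
    assert (Hb : 0 <= sym_sum K (fun k => p k * g k ^ 2)).
    { apply sym_sum_nonneg. intros z. apply Rmult_le_pos; [apply p_nonneg|apply pow2_ge_0]. }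
    set (b := sym_sum K (fun k => p k * g k ^ 2)) in *.
    assert (Hv : 0 <= v) by (apply expect_nonneg; intros; apply pow2_ge_0).
    assert (Hma : m * a <= INR n * a ^ 2).
    { apply Rle_trans with (Rabs (m * a)); [apply Rle_abs|].
      rewrite Rabs_mult, <- (pow2_abs a). pose proof (Rabs_pos a). nra. }
    pose proof (pow2_ge_0 a). pose proof (pos_INR n).
    assert (v * trunc_mass K <= v) by nra.
    assert (trunc_mass K ^ n * b <= b) by nra.
    nra.
Qed.

(** Markov's inequality for the square of the uncentred sum. The summand may have a mean a, whose
    total n a enters squared: this bias is exactly what has to be controlled for the likelihood
    remainder. *)
Lemma chebyshev (n : nat) (g : Z -> R) (a b eps : R) (A : list Z -> Prop) :
  0 < eps -> (forall l, length l = n -> A l -> eps < Rabs (sum_list g l)) ->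
  is_mean p g a -> is_mean p (fun k => g k ^ 2) b ->
  prob_iid p n A <= (INR n * b + INR n ^ 2 * a ^ 2) / eps ^ 2.
Proof.
  intros He HA Ha Hb.
  assert (E2 : 0 < eps ^ 2) by now apply pow_lt.
  eapply (@Rle_cv_lim _ (fun K => (INR n * sym_sum K (fun k => p k * g k ^ 2)
     + INR n ^ 2 * (sym_sum K (fun k => p k * g k) * sym_sum K (fun k => p k * g k))) * / eps ^ 2));
    [|apply prob_iid_cv|].
  - intros K. cbv beta.
    replace (sym_sum K (fun k => p k * g k) * sym_sum K (fun k => p k * g k))
      with (sym_sum K (fun k => p k * g k) ^ 2) by ring.
    apply Rle_trans with (expect K n (fun l => / eps ^ 2 * sum_list g l ^ 2)).
    + apply expect_le. intros l Hl. unfold indic.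
      destruct (excluded_middle_informative (A l)) as [H|H].
      * specialize (HA l Hl H). apply Rmult_le_reg_l with (eps ^ 2); [exact E2|].
        rewrite <- Rmult_assoc, Rinv_r, Rmult_1_r, Rmult_1_l by lra.
        rewrite <- (pow2_abs (sum_list g l)). apply pow_incr. lra.
      * apply Rmult_le_pos; [apply Rlt_le, Rinv_0_lt_compat, E2|apply pow2_ge_0].
    + rewrite expect_scal, Rmult_comm. apply Rmult_le_compat_r;
        [apply Rlt_le, Rinv_0_lt_compat, E2|apply expect_sum_list_sq].
  - replace ((INR n * b + INR n ^ 2 * a ^ 2) / eps ^ 2)
      with ((INR n * b + INR n ^ 2 * (a * a)) * / eps ^ 2) by (unfold Rdiv; ring).
    apply CV_mult; [apply CV_plus; apply CV_mult; try apply Un_cv_const|apply Un_cv_const].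
    + exact Hb.
    + apply CV_mult; exact Ha.
Qed.

Section Lindeberg.
Variables (X : Z -> R) (eta C d : R).
Hypothesis C_nonneg : 0 <= C.
Hypothesis step : forall s y, eta <= s -> exists u1 u2,
    Rabs u1 <= C /\ Rabs u2 <= C /\
    forall X d, 0 <= d ->
      Rabs (Phi ((y - X) / sqrt s) - Phi (y / sqrt (s + d)) - u1 * X - u2 * (X ^ 2 - d))
      <= C * (Rabs X ^ 3 + d ^ 2).
Hypothesis d_nonneg : 0 <= d.

(** The cost of one replacement under the truncated law: its mean, its variance mismatch with d, its
    third moment, and the time error d^2. *)
Definition swap_error (K : nat) : R :=
  C * (Rabs (sym_sum K (fun k => p k * X k))
       + Rabs (sym_sum K (fun k => p k * X k ^ 2) - trunc_mass K * d)
       + sym_sum K (fun k => p k * Rabs (X k) ^ 3) + d ^ 2).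

Lemma swap_one (K : nat) (s y : R) : eta <= s ->
  Rabs (sym_sum K (fun z => p z * Phi ((y - X z) / sqrt s))
        - trunc_mass K * Phi (y / sqrt (s + d))) <= swap_error K.
Proof.
  intros Hs. destruct (step s y Hs) as [u1 [u2 [H1 [H2 H3]]]].
  set (r := fun z => Phi ((y - X z) / sqrt s) - Phi (y / sqrt (s + d)) - u1 * X z
                     - u2 * (X z ^ 2 - d)).
  rewrite (sym_sum_ext K _ (fun z => (u1 * (p z * X z) + u2 * (p z * X z ^ 2))
     + (p z * (Phi (y / sqrt (s + d)) - u2 * d) + p z * r z)))
    by (intros; unfold r; ring).
  rewrite !sym_sum_plus, !sym_sum_scal, sym_sum_p_const.
  set (A := sym_sum K (fun k => p k * X k)). set (B := sym_sum K (fun k => p k * X k ^ 2)).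
  set (T := sym_sum K (fun k => p k * Rabs (X k) ^ 3)). set (q := trunc_mass K).
  assert (Hr : Rabs (sym_sum K (fun z => p z * r z)) <= C * (T + d ^ 2 * q)).
  { eapply Rle_trans; [apply sym_sum_abs|].
    replace (C * (T + d ^ 2 * q)) with (sym_sum K (fun z => C * (p z * Rabs (X z) ^ 3 + p z * d ^ 2))).
    - apply sym_sum_le. intros z _. rewrite Rabs_mult, (Rabs_pos_eq (p z)) by apply p_nonneg.
      replace (C * (p z * Rabs (X z) ^ 3 + p z * d ^ 2))
        with (p z * (C * (Rabs (X z) ^ 3 + d ^ 2))) by ring.
      apply Rmult_le_compat_l; [apply p_nonneg|]. now apply H3.
    - rewrite sym_sum_scal, sym_sum_plus, sym_sum_p_const. reflexivity. }
  set (Q := sym_sum K (fun z => p z * r z)) in *.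
  replace (u1 * A + u2 * B + ((Phi (y / sqrt (s + d)) - u2 * d) * q + Q) - q * Phi (y / sqrt (s + d)))
    with (u1 * A + u2 * (B - q * d) + Q) by ring.
  eapply Rle_trans; [apply Rabs_triang|].
  assert (Rabs (u1 * A + u2 * (B - q * d)) <= C * Rabs A + C * Rabs (B - q * d)).
  { eapply Rle_trans; [apply Rabs_triang|]. rewrite !Rabs_mult.
    apply Rplus_le_compat; apply Rmult_le_compat_r; auto using Rabs_pos. }
  pose proof (trunc_mass_bounds K) as Hq. fold q in Hq.
  assert (C * (d ^ 2 * q) <= C * d ^ 2).
  { apply Rmult_le_compat_l; [exact C_nonneg|]. pose proof (pow2_ge_0 d). nra. }
  unfold swap_error. fold A B T q. lra.
Qed.

Lemma swap_error_nonneg (K : nat) : 0 <= swap_error K.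
Proof.
  apply Rmult_le_pos; [exact C_nonneg|].
  assert (0 <= sym_sum K (fun k => p k * Rabs (X k) ^ 3)).
  { apply sym_sum_nonneg. intros z. apply Rmult_le_pos; [apply p_nonneg|apply pow_le, Rabs_pos]. }
  pose proof (Rabs_pos (sym_sum K (fun k => p k * X k))).
  pose proof (Rabs_pos (sym_sum K (fun k => p k * X k ^ 2) - trunc_mass K * d)).
  pose proof (pow2_ge_0 d). lra.
Qed.

(** Each increment is traded for an amount d of variance in the heat solution. The induction
    hypothesis, used at the shifted level y - X z, treats the tail of the list; [swap_one] then
    treats its head. Total masses at most 1 keep the errors additive. *)
Lemma swap_all (K n : nat) (y : R) :
  Rabs (expect K n (fun l => Phi ((y - sum_list X l) / sqrt eta))
        - trunc_mass K ^ n * Phi (y / sqrt (eta + INR n * d))) <= INR n * swap_error K.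
Proof.
  revert y. induction n as [|n IH]; intros y.
  - rewrite expect_0. simpl. rewrite Rminus_0_r, !Rmult_0_l, Rplus_0_r, Rmult_1_l, Rminus_diag, Rabs_R0.
    lra.
  - rewrite expect_S. set (q := trunc_mass K) in *. set (s := eta + INR n * d) in *.
    set (e := fun z => expect K n (fun l => Phi ((y - X z - sum_list X l) / sqrt eta))
                       - q ^ n * Phi ((y - X z) / sqrt s)).
    rewrite (sym_sum_ext K _ (fun z => q ^ n * (p z * Phi ((y - X z) / sqrt s)) + p z * e z)).
    2: { intros z _. unfold e.
         rewrite (expect_ext K n _ (fun l => Phi ((y - X z - sum_list X l) / sqrt eta))).
         - ring.
         - intros l _. simpl. do 2 f_equal. ring. }
    rewrite sym_sum_plus, sym_sum_scal.
    assert (Hs : eta <= s) by (unfold s; pose proof (pos_INR n); nra).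
    pose proof (swap_one K s y Hs) as H1. fold q in H1.
    pose proof (trunc_mass_bounds K) as Hq. fold q in Hq.
    pose proof (trunc_mass_pow_le K n) as Hqn. fold q in Hqn.
    pose proof (swap_error_nonneg K) as HE.
    assert (He : Rabs (sym_sum K (fun z => p z * e z)) <= INR n * swap_error K).
    { eapply Rle_trans; [apply sym_sum_abs|].
      apply Rle_trans with (sym_sum K (fun z => p z * (INR n * swap_error K))).
      - apply sym_sum_le. intros z _. rewrite Rabs_mult, (Rabs_pos_eq (p z)) by apply p_nonneg.
        apply Rmult_le_compat_l; [apply p_nonneg|apply IH].
      - rewrite sym_sum_p_const. fold q. pose proof (pos_INR n).
        assert (0 <= INR n * swap_error K) by now apply Rmult_le_pos. nra. }
    replace (eta + INR (S n) * d) with (s + d) by (unfold s; rewrite S_INR; ring).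
    set (G := sym_sum K (fun z => p z * Phi ((y - X z) / sqrt s))) in *.
    replace (q ^ n * G + sym_sum K (fun z => p z * e z) - q ^ S n * Phi (y / sqrt (s + d)))
      with (q ^ n * (G - q * Phi (y / sqrt (s + d))) + sym_sum K (fun z => p z * e z))
      by (simpl; ring).
    eapply Rle_trans; [apply Rabs_triang|].
    rewrite Rabs_mult, (Rabs_pos_eq (q ^ n)), S_INR by lra.
    pose proof (Rabs_pos (G - q * Phi (y / sqrt (s + d)))). nra.
Qed.

Variables (b tau : R).
Hypothesis X_mean : is_mean p X 0.
Hypothesis X_var : is_mean p (fun k => X k ^ 2) b.
Hypothesis X_third : is_mean p (fun k => Rabs (X k) ^ 3) tau.

Lemma Un_cv_Rabs (u : nat -> R) (l : R) : Un_cv u l -> Un_cv (fun n => Rabs (u n)) (Rabs l).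
Proof. intros H. apply (cv_cvabs u l H). Qed.

Lemma trunc_mass_pow_cv (n : nat) : Un_cv (fun K => trunc_mass K ^ n) 1.
Proof.
  induction n as [|n IH]; [apply (Un_cv_const 1)|].
  rewrite <- (Rmult_1_r 1). apply (CV_mult _ _ _ _ p_mass IH).
Qed.

Definition swap_limit : R := C * (Rabs (b - d) + tau + d ^ 2).

Lemma swap_error_cv : Un_cv swap_error swap_limit.
Proof.
  unfold swap_limit, swap_error.
  replace (C * (Rabs (b - d) + tau + d ^ 2))
    with (C * (Rabs 0 + Rabs (b - 1 * d) + tau + d ^ 2)) by (rewrite Rabs_R0, Rmult_1_l; ring).
  apply CV_mult; [apply Un_cv_const|].
  repeat apply CV_plus; try apply Un_cv_const.
  - apply Un_cv_Rabs, X_mean.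
  - apply Un_cv_Rabs, CV_minus; [exact X_var|].
    apply CV_mult; [exact p_mass|apply Un_cv_const].
  - exact X_third.
Qed.

(** The indicator of S <= x is squeezed between Phi((x - del - S) / sqrt eta) and Phi((x + del - S)
    / sqrt eta), up to the tail [gauss (del / sqrt eta)]. The replacement applies to these smooth
    functions, and then K tends to infinity. *)
Lemma normal_approx (n : nat) (A : list Z -> Prop) (x del : R) :
  0 < eta -> 0 < del ->
  (forall l, length l = n -> (A l <-> sum_list X l <= x)) ->
  Phi ((x - del) / sqrt (eta + INR n * d)) - gauss (del / sqrt eta) - INR n * swap_limit
  <= prob_iid p n A <=
  Phi ((x + del) / sqrt (eta + INR n * d)) + gauss (del / sqrt eta) + INR n * swap_limit.
Proof.
  intros Heta Hdel HA.
  assert (S0 : 0 < sqrt eta) by now apply sqrt_lt_R0.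
  assert (Hz : 0 <= del / sqrt eta) by (apply Rlt_le, Rdiv_lt_0_compat; assumption).
  pose proof (Phi_tail _ Hz) as Htail.
  set (g := gauss (del / sqrt eta)) in *.
  assert (Hup : forall l, length l = n ->
     indic (A l) <= Phi ((x + del - sum_list X l) / sqrt eta) + g).
  { intros l Hl. unfold indic. destruct (excluded_middle_informative (A l)) as [H|H].
    - apply (HA l Hl) in H.
      assert (Phi (del / sqrt eta) <= Phi ((x + del - sum_list X l) / sqrt eta)).
      { apply Phi_mono. apply Rmult_le_compat_r; [apply Rlt_le, Rinv_0_lt_compat, S0|lra]. }
      lra.
    - pose proof (Phi_bounds ((x + del - sum_list X l) / sqrt eta)).
      pose proof (gauss_pos (del / sqrt eta)). fold g in H1. lra. }
  assert (Hlo : forall l, length l = n ->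
     Phi ((x - del - sum_list X l) / sqrt eta) <= indic (A l) + g).
  { intros l Hl. unfold indic. destruct (excluded_middle_informative (A l)) as [H|H].
    - pose proof (Phi_bounds ((x - del - sum_list X l) / sqrt eta)).
      pose proof (gauss_pos (del / sqrt eta)). fold g in H1. lra.
    - assert (x < sum_list X l).
      { apply Rnot_le_lt. intros H1. apply H. now apply (HA l Hl). }
      assert (Phi ((x - del - sum_list X l) / sqrt eta) <= Phi (- (del / sqrt eta))).
      { apply Phi_mono. unfold Rdiv. rewrite Ropp_mult_distr_l.
        apply Rmult_le_compat_r; [apply Rlt_le, Rinv_0_lt_compat, S0|lra]. }
      rewrite Phi_opp in H1. lra. }
  assert (Hcv : forall y, Un_cv (fun K => trunc_mass K ^ n * (Phi y + g) + INR n * swap_error K)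
                           (1 * (Phi y + g) + INR n * swap_limit)).
  { intros y. apply CV_plus; apply CV_mult; try apply Un_cv_const.
    - apply trunc_mass_pow_cv.
    - apply swap_error_cv. }
  split.
  - assert (L : Phi ((x - del) / sqrt (eta + INR n * d)) <=
                prob_iid p n A + 1 * (0 + g) + INR n * swap_limit).
    { apply (@Rle_cv_lim (fun K => trunc_mass K ^ n * Phi ((x - del) / sqrt (eta + INR n * d)))
        (fun K => expect K n (fun l => indic (A l)) + trunc_mass K ^ n * (0 + g)
                  + INR n * swap_error K)).
      - intros K. pose proof (swap_all K n (x - del)) as H. apply Rabs_le_between in H.
        assert (expect K n (fun l => Phi ((x - del - sum_list X l) / sqrt eta))
                <= expect K n (fun l => indic (A l) + g)) by now apply expect_le.
        rewrite expect_plus, expect_const in H0. lra.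
      - pose proof (CV_mult _ _ _ _ (trunc_mass_pow_cv n)
          (Un_cv_const (Phi ((x - del) / sqrt (eta + INR n * d))))) as H.
        rewrite Rmult_1_l in H. exact H.
      - apply CV_plus; [apply CV_plus|].
        + apply prob_iid_cv.
        + apply CV_mult; [apply trunc_mass_pow_cv|apply Un_cv_const].
        + apply CV_mult; [apply Un_cv_const|apply swap_error_cv]. }
    lra.
  - assert (L : prob_iid p n A <= 1 * (Phi ((x + del) / sqrt (eta + INR n * d)) + g)
                                  + INR n * swap_limit).
    { eapply (@Rle_cv_lim _ _ _ _); [|apply prob_iid_cv|apply Hcv].
      intros K. cbv beta. pose proof (swap_all K n (x + del)) as H. apply Rabs_le_between in H.
      assert (expect K n (fun l => indic (A l))
              <= expect K n (fun l => Phi ((x + del - sum_list X l) / sqrt eta) + g))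
        by now apply expect_le.
      rewrite expect_plus, expect_const in H0. lra. }
    lra.
Qed.

End Lindeberg.
End Expectation.

(** * The central sequence *)

Lemma IZR_abs_le_sq (k : Z) : 0 <= IZR (Z.abs k) <= IZR k ^ 2.
Proof.
  split; [apply (IZR_le 0); lia|].
  replace (IZR k ^ 2) with (IZR (k * k)) by (rewrite mult_IZR; ring).
  apply IZR_le. nia.
Qed.

(** Here lam^2 phi is the second moment of |k| + lam h - lam, whose leading part E k^2 = lam
    contributes exactly T / th. Since |k| <= k^2 on the integers and 0 <= h <= 1, the other terms
    total at most 3 lam^2. *)
Lemma information_limit (th D T : R) : 0 < th -> 0 < D -> th * D <= 1 -> 0 < T ->
  Rabs (T * D * phiD th D - T / th) <= 3 * T * D.
Proof.
  intros Hth HD H1 HT. set (lam := th * D). assert (Hl : 0 < lam) by (unfold lam; nra).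
  fold lam in H1.
  set (F := fun k => (hD D th k + IZR (Z.abs k) / lam - 1) ^ 2).
  destruct (is_mean_dominated (fD D th) (fun k => lam ^ 2 * F k - IZR k ^ 2)
    (fun k => 2 * lam * IZR k ^ 2 + lam ^ 2 * 1) (2 * lam * lam + lam ^ 2 * 1)
    (fD_nonneg D th Hl)) as [e [He Heb]].
  - intros k. pose proof (hD_bounds D th Hl k) as Hh. fold lam in Hh.
    pose proof (IZR_abs_le_sq k) as Hk.
    assert (E : IZR k ^ 2 = IZR (Z.abs k) ^ 2) by (rewrite abs_IZR; symmetry; apply pow2_abs).
    replace (lam ^ 2 * F k - IZR k ^ 2)
      with (2 * lam * (hD D th k - 1) * IZR (Z.abs k) + lam ^ 2 * (hD D th k - 1) ^ 2)
      by (rewrite E; unfold F; field; lra).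
    set (h := hD D th k) in *. set (a := IZR (Z.abs k)) in *.
    assert (0 <= lam * a) by nra.
    assert (0 <= (1 - h) * (lam * a) <= lam * a) by nra.
    assert (0 <= (h - 1) ^ 2 <= 1) by nra.
    assert (0 <= lam ^ 2 * (h - 1) ^ 2 <= lam ^ 2) by (pose proof (pow2_ge_0 lam); nra).
    assert (lam * a <= lam * IZR k ^ 2) by nra.
    apply Rabs_le. nra.
  - apply is_mean_plus; apply is_mean_scal; [apply fD_moment2|apply fD_mass]; exact Hl.
  - assert (HF : is_mean (fD D th) F (/ lam ^ 2 * (e + lam))).
    { eapply is_mean_ext; [|exact (is_mean_scal _ _ (/ lam ^ 2) _
        (is_mean_plus _ _ _ _ _ He (fD_moment2 D th Hl)))].
      intros k. cbv beta. field. lra. }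
    replace (phiD th D) with (/ lam ^ 2 * (e + lam)) by (symmetry; now apply lim_seq_eq).
    replace (T * D * (/ lam ^ 2 * (e + lam)) - T / th) with (T * D * (e / lam ^ 2))
      by (unfold lam; field; lra).
    rewrite Rabs_mult, Rabs_pos_eq by nra.
    replace (3 * T * D) with (T * D * 3) by ring.
    apply Rmult_le_compat_l; [nra|].
    unfold Rdiv. rewrite Rabs_mult, (Rabs_pos_eq (/ _))
      by (apply Rlt_le, Rinv_0_lt_compat, pow_lt; lra).
    apply Rle_div_l; [apply pow_lt; lra|]. nra.
Qed.

(** The statistic in [LAN] is a function of the observed path, so the increments are recovered from
    it by differences. *)
Fixpoint path_sum (g : Z -> R) (x : list Z) : R :=
  match x with
  | a :: ((b :: _) as x') => g (b - a)%Z + path_sum g x'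
  | _ => 0
  end.

Lemma path_sum_psums (g : Z -> R) (s : Z) (y : list Z) :
  path_sum g (s :: psums s y) = sum_list g y.
Proof.
  revert s. induction y as [|z y IH]; intros s; [reflexivity|].
  change (g (s + z - s)%Z + path_sum g ((s + z)%Z :: psums (s + z) y) = g z + sum_list g y).
  rewrite IH. do 2 f_equal. lia.
Qed.

Lemma ln_lr_path_psums (p q : Z -> R) (s : Z) (y : list Z) :
  (forall k, 0 < p k) -> (forall k, 0 < q k) ->
  ln (lr_path p q (s :: psums s y)) = sum_list (fun k => ln (p k / q k)) y.
Proof.
  intros Hp Hq.
  assert (H : forall y s, 0 < lr_path p q (s :: psums s y)).
  { clear s y. induction y as [|z y IH]; intros s; [simpl; lra|].
    apply (Rmult_lt_0_compat (p (s + z - s)%Z / q (s + z - s)%Z)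
             (lr_path p q ((s + z)%Z :: psums (s + z) y))); [|apply IH].
    now apply Rdiv_lt_0_compat. }
  revert s. induction y as [|z y IH]; intros s; [simpl; apply ln_1|].
  change (ln (p (s + z - s)%Z / q (s + z - s)%Z * lr_path p q ((s + z)%Z :: psums (s + z) y))
          = ln (p z / q z) + sum_list (fun k => ln (p k / q k)) y).
  rewrite ln_mult; [|now apply Rdiv_lt_0_compat|apply H].
  rewrite IH. replace (s + z - s)%Z with z by lia. reflexivity.
Qed.

Lemma sum_list_affine (a b : Z -> R) (v c : R) (l : list Z) :
  sum_list (fun k => a k - v * b k + c) l
  = sum_list a l - v * sum_list b l + INR (length l) * c.
Proof.
  induction l as [|z l IH]; [simpl; ring|].
  simpl length. rewrite S_INR. simpl sum_list. rewrite IH. ring.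
Qed.

(** The floor loses at most one step D. The bound by 1 makes it legitimate to divide by the number
    of observations. *)
Lemma nobs_bounds (th T D : R) : 0 < th -> 0 < D <= T ->
  1 <= INR (nobs T D) /\
  th * T - th * D < INR (nobs T D) * (th * D) <= th * T.
Proof.
  intros Hth HD. unfold nobs. destruct (base_Int_part (T / D)) as [H1 H2].
  assert (H3 : 1 <= T / D) by (apply Rle_div_r; lra).
  assert (H4 : (1 <= Int_part (T / D))%Z).
  { assert (0 < IZR (Int_part (T / D))) as H5 by lra. apply lt_IZR in H5. lia. }
  rewrite INR_IZR_INZ, Z2Nat.id by lia.
  split; [now apply (IZR_le 1)|].
  set (N := IZR (Int_part (T / D))) in *. split.
  - assert (T < (N + 1) * D) by (apply Rlt_div_l; lra). nra.
  - assert (N * D <= T) by (apply Rle_div_r; lra). nra.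
Qed.

Definition abs_mean (D th : R) : R := zsum (fun k => fD D th k * IZR (Z.abs k)).

Lemma abs_mean_spec (D th : R) : 0 < th * D ->
  is_mean (fD D th) (fun k => IZR (Z.abs k)) (abs_mean D th) /\
  is_mean (fD D th) (hD D th) (1 - abs_mean D th / (th * D)) /\
  0 <= abs_mean D th <= th * D /\ th * D - abs_mean D th <= (th * D) ^ 2.
Proof.
  intros H. destruct (fD_mean_abs D th H) as [m [Hm H2]].
  replace (abs_mean D th) with m by (symmetry; now apply lim_seq_eq).
  now split.
Qed.

(* The central sequence [xi_T] is the sum of these over the increments. *)
Definition std_abs (D th T : R) (k : Z) : R :=
  (IZR (Z.abs k) - abs_mean D th) / sqrt (th * T).

(** For the third moment: if k <> 0 then |k| >= 1 >= m and (|k| - m)^3 <= k^4, while k = 0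
    contributes m^3 <= m. The total 3 lam^2 + lam + m is at most 5 lam. It is of order lam and not
    lam^(3/2), as for rare jumps of size 1. *)
Lemma centred_abs_moments (D th : R) : 0 < th * D <= 1 ->
  is_mean (fD D th) (fun k => IZR (Z.abs k) - abs_mean D th) 0 /\
  is_mean (fD D th) (fun k => (IZR (Z.abs k) - abs_mean D th) ^ 2)
    (th * D - abs_mean D th ^ 2) /\
  exists t, is_mean (fD D th) (fun k => Rabs (IZR (Z.abs k) - abs_mean D th) ^ 3) t /\
    Rabs t <= 5 * (th * D).
Proof.
  intros H. destruct (abs_mean_spec D th ltac:(lra)) as [Hm [_ [Hm1 Hm2]]].
  pose proof (fD_mass D th ltac:(lra)) as M0. pose proof (fD_moment2 D th ltac:(lra)) as M2.
  pose proof (fD_moment4 D th ltac:(lra)) as M4.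
  set (m := abs_mean D th) in *. set (lam := th * D) in *. repeat split.
  - replace 0 with (m + (- m) * 1) by ring.
    eapply is_mean_ext; [|exact (is_mean_plus _ _ _ _ _ Hm (is_mean_scal _ _ (- m) _ M0))].
    intros k. cbv beta. ring.
  - replace (lam - m ^ 2) with (lam + ((- 2 * m) * m + m ^ 2 * 1)) by ring.
    eapply is_mean_ext; [|exact (is_mean_plus _ _ _ _ _ M2 (is_mean_plus _ _ _ _ _
       (is_mean_scal _ _ (- 2 * m) _ Hm) (is_mean_scal _ _ (m ^ 2) _ M0)))].
    intros k. cbv beta.
    replace (IZR k ^ 2) with (IZR (Z.abs k) ^ 2) by (rewrite abs_IZR; apply pow2_abs). ring.
  - destruct (is_mean_dominated (fD D th) (fun k => Rabs (IZR (Z.abs k) - m) ^ 3)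
      (fun k => IZR k ^ 4 + m * 1) (3 * lam ^ 2 + lam + m * 1)
      (fD_nonneg D th ltac:(unfold lam in *; lra))) as [t [Ht Htb]].
    + intros k. rewrite <- RPow_abs, Rabs_Rabsolu, Rmult_1_r.
      replace (IZR k ^ 4) with (IZR (Z.abs k) ^ 4).
      2: { rewrite abs_IZR. replace (Rabs (IZR k) ^ 4) with ((Rabs (IZR k) ^ 2) ^ 2) by ring.
           rewrite pow2_abs. ring. }
      destruct (Z.eq_dec k 0) as [->|Hk].
      * simpl Z.abs. rewrite Rminus_0_l, Rabs_Ropp, Rabs_pos_eq by lra.
        assert (m ^ 2 <= 1) by nra. assert (0 <= m ^ 2) by nra. simpl in *. nra.
      * assert (1 <= IZR (Z.abs k)) as H1 by (apply IZR_le; lia).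
        set (a := IZR (Z.abs k)) in *. rewrite Rabs_pos_eq by lra.
        assert ((a - m) ^ 3 <= a ^ 3) by (apply pow_incr; lra).
        assert (0 <= a ^ 3) by (apply pow_le; lra).
        replace (a ^ 4) with (a * a ^ 3) by ring. nra.
    + apply is_mean_plus; [exact M4|now apply is_mean_scal].
    + exists t. split; [exact Ht|]. nra.
Qed.

(* The smoothing width [del] and the smoothing variance [del ^ 4] make the
   smoothing error [gauss (del / sqrt (del ^ 4))] of order [del ^ 2]. *)
Lemma std_abs_normal_approx (x del : R) : 0 < del <= 1 / 2 ->
  exists C, 0 <= C /\ forall th D T (A : list Z -> Prop),
    0 < th -> 0 < D <= T -> 1 <= sqrt (th * T) -> th * D <= 1 / 4 ->
    (forall l, length l = nobs T D -> (A l <-> sum_list (std_abs D th T) l <= x)) ->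
    Rabs (prob_iid (fD D th) (nobs T D) A - Phi x)
    <= (6 + 2 * Rabs x) * del + (2 * Rabs x + C) * (th * D + / sqrt (th * T)).
Proof.
  intros Hdel.
  assert (Heta : 0 < del ^ 4) by (apply pow_lt; lra).
  destruct (Phi_lindeberg_step (del ^ 4) Heta) as [C [HC step]].
  exists (5 * C). split; [lra|].
  intros th D T A Hth HD HR Hlam HA.
  set (R0 := sqrt (th * T)) in *. set (lam := th * D) in *. set (n := nobs T D) in *.
  assert (Hlp : 0 < lam) by (unfold lam; nra).
  assert (ER : R0 ^ 2 = th * T) by (apply pow2_sqrt; nra).
  destruct (nobs_bounds th T D Hth HD) as [Hn1 Hn]. fold n lam in Hn1, Hn. rewrite <- ER in Hn.
  destruct (centred_abs_moments D th) as [M1 [M2 [t [M3 Ht]]]]; [fold lam; lra|].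
  destruct (abs_mean_spec D th Hlp) as [_ [_ [Hm _]]].
  set (m := abs_mean D th) in *. fold lam in M2, Ht, Hm.
  set (i := / R0). assert (Hi : 0 < i <= 1).
  { split; [apply Rinv_0_lt_compat; lra|]. rewrite <- Rinv_1. apply Rinv_le_contravar; lra. }
  assert (Ei : R0 * i = 1) by (apply Rinv_r; lra).
  assert (X1 : is_mean (fD D th) (std_abs D th T) 0).
  { replace 0 with (i * 0) by ring.
    eapply is_mean_ext; [|exact (is_mean_scal _ _ i _ M1)].
    intros k. unfold std_abs. fold R0 m. unfold Rdiv. fold i. ring. }
  assert (X2 : is_mean (fD D th) (fun k => std_abs D th T k ^ 2) (i ^ 2 * (lam - m ^ 2))).
  { eapply is_mean_ext; [|exact (is_mean_scal _ _ (i ^ 2) _ M2)].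
    intros k. unfold std_abs. fold R0 m. unfold Rdiv. fold i. ring. }
  assert (X3 : is_mean (fD D th) (fun k => Rabs (std_abs D th T k) ^ 3) (i ^ 3 * t)).
  { eapply is_mean_ext; [|exact (is_mean_scal _ _ (i ^ 3) _ M3)].
    intros k. unfold std_abs. fold R0 m. unfold Rdiv. fold i.
    rewrite Rabs_mult, (Rabs_pos_eq i) by lra. ring. }
  (* The replacing variance is lam / (th T), not the exact (lam - m^2) / (th T). Then n d lies in
     [1 - lam, 1], and the total mismatch, n m^2 / (th T), is at most lam. *)
  set (d := i ^ 2 * lam).
  assert (Hd : 0 <= d) by (apply Rmult_le_pos; [apply pow2_ge_0|lra]).
  pose proof (normal_approx (fD D th) (fD_nonneg D th Hlp) (fD_mass D th Hlp)
    (std_abs D th T) (del ^ 4) C d HC step Hd _ _ X1 X2 X3 n A x del Heta ltac:(lra) HA) as N.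
  assert (Hsw : INR n * swap_limit C d (i ^ 2 * (lam - m ^ 2)) (i ^ 3 * t)
                <= 5 * C * (lam + i)).
  { unfold swap_limit.
    replace (i ^ 2 * (lam - m ^ 2) - d) with (- (i ^ 2 * m ^ 2)) by (unfold d; ring).
    rewrite Rabs_Ropp, Rabs_pos_eq by (apply Rmult_le_pos; apply pow2_ge_0).
    assert (B0 : 0 <= i ^ 2) by apply pow2_ge_0.
    assert (Hnl : INR n * lam * i ^ 2 <= 1).
    { replace 1 with (R0 ^ 2 * i ^ 2)
        by (replace (R0 ^ 2 * i ^ 2) with ((R0 * i) ^ 2) by ring; rewrite Ei; ring).
      apply Rmult_le_compat_r; lra. }
    assert (Hnl0 : 0 <= INR n * lam * i ^ 2) by (apply Rmult_le_pos; nra).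
    assert (m ^ 2 <= lam * lam) by nra.
    assert (K1 : INR n * (i ^ 2 * m ^ 2) <= lam).
    { apply Rle_trans with (INR n * lam * i ^ 2 * lam); [|nra].
      replace (INR n * lam * i ^ 2 * lam) with (INR n * i ^ 2 * (lam * lam)) by ring.
      rewrite <- Rmult_assoc. apply Rmult_le_compat_l; [nra|assumption]. }
    assert (K2 : INR n * (i ^ 3 * t) <= 5 * i).
    { apply Rabs_le_between in Ht.
      apply Rle_trans with (INR n * lam * i ^ 2 * (5 * i)); [|nra].
      replace (INR n * lam * i ^ 2 * (5 * i)) with (INR n * i ^ 3 * (5 * lam)) by ring.
      rewrite <- Rmult_assoc. apply Rmult_le_compat_l; [|lra].
      apply Rmult_le_pos; [lra|apply pow_le; lra]. }
    assert (K3 : INR n * d ^ 2 <= lam).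
    { unfold d. replace (INR n * (i ^ 2 * lam) ^ 2) with (INR n * lam * i ^ 2 * (i ^ 2 * lam)) by ring.
      assert (I1 : i ^ 2 <= 1) by nra.
      assert (L1 : 0 <= i ^ 2 * lam <= lam)
        by (split; [apply Rmult_le_pos; lra|rewrite <- (Rmult_1_l lam) at 2;
                    apply Rmult_le_compat_r; lra]).
      nra. }
    replace (INR n * (C * (i ^ 2 * m ^ 2 + i ^ 3 * t + d ^ 2)))
      with (C * (INR n * (i ^ 2 * m ^ 2) + INR n * (i ^ 3 * t) + INR n * d ^ 2)) by ring.
    replace (5 * C * (lam + i)) with (C * (5 * (lam + i))) by ring.
    apply Rmult_le_compat_l; lra. }
  set (E := INR n * swap_limit C d _ _) in *.
  set (s := del ^ 4 + INR n * d) in *.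
  assert (Hs : Rabs (s - 1) <= del + lam /\ 1 / 2 <= s).
  { assert (I2 : R0 ^ 2 * i ^ 2 = 1)
      by (replace (R0 ^ 2 * i ^ 2) with ((R0 * i) ^ 2) by ring; rewrite Ei; ring).
    assert (i ^ 2 <= 1) by nra. assert (B0 : 0 < i ^ 2) by (apply pow_lt; lra).
    assert (1 - lam <= INR n * d <= 1) by (unfold d; nra).
    assert (del ^ 4 <= del).
    { replace (del ^ 4) with (del ^ 3 * del) by ring.
      assert (del ^ 3 <= 1 ^ 3) by (apply pow_incr; lra). nra. }
    unfold s. split; [apply Rabs_le; lra|lra]. }
  destruct Hs as [Hs1 Hs2].
  assert (Sq : 1 / 2 <= sqrt s).
  { rewrite <- (sqrt_pow2 (1 / 2)) by lra. apply sqrt_le_1_alt. lra. }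
  assert (Hscale : forall y, Rabs (y - x) <= del ->
            Rabs (Phi (y / sqrt s) - Phi x) <= 2 * del + 2 * Rabs x * (del + lam)).
  { intros y Hy. eapply Rle_trans; [apply Phi_lipschitz|].
    set (u := sqrt s) in *. assert (Eu : u * u = s) by (apply sqrt_sqrt; lra).
    (* Separates the shift of the argument, of size del, from the effect of the total variance s not
       being exactly 1. *)
    replace (y / u - x) with ((y - x) / u - x * ((s - 1) / (u * (u + 1)))).
    2: { rewrite <- Eu. field. lra. }
    eapply Rle_trans; [apply Rabs_triang|]. rewrite Rabs_Ropp.
    apply Rplus_le_compat.
    - unfold Rdiv. rewrite Rabs_mult, (Rabs_pos_eq (/ u))
        by (apply Rlt_le, Rinv_0_lt_compat; lra).
      apply Rle_div_l; [lra|]. nra.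
    - rewrite Rabs_mult, (Rmult_comm 2), Rmult_assoc. apply Rmult_le_compat_l; [apply Rabs_pos|].
      unfold Rdiv. rewrite Rabs_mult, (Rabs_pos_eq (/ _))
        by (apply Rlt_le, Rinv_0_lt_compat; nra).
      apply Rle_div_l; [nra|]. pose proof (Rabs_pos (s - 1)).
      assert (1 / 2 <= u * (u + 1)) by nra. nra. }
  assert (Hg : gauss (del / sqrt (del ^ 4)) <= 4 * del).
  { replace (del ^ 4) with ((del ^ 2) ^ 2) by ring. rewrite sqrt_pow2 by (apply pow2_ge_0).
    replace (del / del ^ 2) with (/ del) by (field; lra).
    pose proof (gauss_poly_bound (/ del)) as P. pose proof (gauss_pos (/ del)) as G.
    set (g := gauss (/ del)) in *. set (j := / del) in *.
    assert (Ej : del * j = 1) by (apply Rinv_r; lra).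
    assert (j2 : j ^ 2 / 4 <= (1 + j ^ 2 / 4) ^ 2) by (pose proof (pow2_ge_0 j); nra).
    assert (j ^ 2 / 4 * g <= 1) by (assert (j ^ 2 / 4 * g <= (1 + j ^ 2 / 4) ^ 2 * g)
      by (apply Rmult_le_compat_r; lra); lra).
    assert (g = del ^ 2 * (j ^ 2 * g)).
    { replace (del ^ 2 * (j ^ 2 * g)) with ((del * j) ^ 2 * g) by ring. rewrite Ej. ring. }
    assert (del ^ 2 <= del) by nra. assert (0 < del ^ 2) by (apply pow_lt; lra). nra. }
  pose proof (Hscale (x + del)) as U1. pose proof (Hscale (x - del)) as U2.
  replace (x + del - x) with del in U1 by ring. replace (x - del - x) with (- del) in U2 by ring.
  rewrite Rabs_Ropp in U2. rewrite Rabs_pos_eq in U1, U2 by lra.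
  specialize (U1 (Rle_refl _)). specialize (U2 (Rle_refl _)).
  apply Rabs_le_between in U1, U2. pose proof (Rabs_pos x) as Px.
  assert (0 <= Rabs x * i) by (apply Rmult_le_pos; lra).
  apply Rabs_le. fold i.
  replace ((6 + 2 * Rabs x) * del + (2 * Rabs x + 5 * C) * (lam + i))
    with (4 * del + (2 * del + 2 * Rabs x * (del + lam)) + 5 * C * (lam + i) + 2 * (Rabs x * i))
    by ring.
  lra.
Qed.

Lemma log_ratio_expansion (D th r : R) (k : Z) :
  0 < th -> 0 < th * D <= 1 -> bessel_const * Rabs r <= 1 ->
  Rabs (ln (fD D (th * (1 + r)) k / fD D th k)
        - (- (th * D * r) + IZR (Z.abs k) * ln (1 + r) + th * D * r * hD D th k))
  <= 2 * bessel_const * (th * D * r) ^ 2.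
Proof.
  intros Hth Hl Hr. pose proof bessel_const_ge as HC.
  assert (Hr2 : Rabs r <= 1 / 4) by (pose proof (Rabs_pos r); nra).
  apply Rabs_le_between in Hr2.
  pose proof (besselI_log_ratio (Z.abs_nat k) (th * D) r Hl Hr) as H.
  unfold fD at 1 2. replace (th * (1 + r) * D) with (th * D * (1 + r)) by ring.
  set (lam := th * D) in *.
  assert (P1 : 0 < besselI (Z.abs_nat k) lam) by (apply besselI_pos; lra).
  assert (P2 : 0 < besselI (Z.abs_nat k) (lam * (1 + r))) by (apply besselI_pos; nra).
  replace (exp (- (lam * (1 + r))) * besselI (Z.abs_nat k) (lam * (1 + r)) /
           (exp (- lam) * besselI (Z.abs_nat k) lam))
    with (exp (- (lam * r)) * (besselI (Z.abs_nat k) (lam * (1 + r)) / besselI (Z.abs_nat k) lam)).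
  2: { replace (- (lam * (1 + r))) with (- lam + - (lam * r)) by ring. rewrite exp_plus.
       field. split; [lra|]. apply Rgt_not_eq, exp_pos. }
  rewrite ln_mult, ln_exp; [|apply exp_pos|now apply Rdiv_lt_0_compat].
  unfold hD. fold lam.
  replace (IZR (Z.abs k)) with (INR (Z.abs_nat k)) by (rewrite INR_IZR_INZ; f_equal; lia).
  match goal with |- Rabs ?e <= _ => match type of H with Rabs ?f <= _ =>
    replace e with f by ring end end.
  exact H.
Qed.

(** * The remainder *)

(** The share of one increment in r_T: the constant v^2 / 2 is spread evenly over the observations,
    so that the sum over the increments is r_T itself. *)
Definition lan_remainder (D th T v : R) (k : Z) : R :=
  ln (fD D (th * (1 + v / sqrt (th * T))) k / fD D th k)
  - v * std_abs D th T k + v ^ 2 / 2 / INR (nobs T D).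

(** In n a the surviving terms are n m (ln (1 + r) - r), close to - n m r^2 / 2 and hence to - v^2 /
    2, the compensating v^2 / 2, and the Bessel remainder, of order n lam^2 r^2. In n b every term
    already carries a factor lam or 1 / sqrt (th T), so crude bounds suffice. *)
Lemma lan_remainder_moments (v : R) :
  exists M, 0 <= M /\ forall D th T,
    0 < th -> 0 < D <= T -> 1 <= sqrt (th * T) -> th * D <= 1 / 4 ->
    bessel_const * Rabs (v / sqrt (th * T)) <= 1 ->
    exists a b, is_mean (fD D th) (lan_remainder D th T v) a /\
      is_mean (fD D th) (fun k => lan_remainder D th T v k ^ 2) b /\
      Rabs (INR (nobs T D) * a) <= M * (th * D + / sqrt (th * T)) /\
      INR (nobs T D) * b <= M * (th * D + / sqrt (th * T)).
Proof.
  set (V := v ^ 2). assert (HV : 0 <= V) by apply pow2_ge_0.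
  pose proof bessel_const_ge as HC. pose proof (Rabs_pos v) as Hv.
  (* The first three summands serve the mean, the parenthesis serves the second moment. *)
  exists (2 * V * Rabs v + V + 2 * bessel_const * V + (10 * V ^ 2 + 64 * V)).
  assert (HV2 : 0 <= V ^ 2) by apply pow2_ge_0.
  assert (HVv : 0 <= V * Rabs v) by now apply Rmult_le_pos.
  assert (HCV : 0 <= bessel_const * V) by (apply Rmult_le_pos; lra).
  split; [lra|].
  intros D th T Hth HD HR Hlam Hr.
  assert (Hlp : 0 < th * D) by nra.
  destruct (nobs_bounds th T D Hth HD) as [Hn1 Hn].
  destruct (abs_mean_spec D th Hlp) as [Hm [Hh [Hm1 Hm2]]].
  assert (ER : sqrt (th * T) ^ 2 = th * T) by (apply pow2_sqrt; nra).
  pose proof (fD_nonneg D th Hlp) as Hp. pose proof (fD_mass D th Hlp) as M0.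
  pose proof (fD_moment2 D th Hlp) as M2.
  set (g := lan_remainder D th T v).
  assert (Eg : forall k, g k = ln (fD D (th * (1 + v / sqrt (th * T))) k / fD D th k)
     - v / sqrt (th * T) * (IZR (Z.abs k) - abs_mean D th) + V / 2 / INR (nobs T D)).
  { intros k. unfold g, lan_remainder, std_abs, V. field. lra. }
  clearbody g.
  set (R0 := sqrt (th * T)) in *. set (n := INR (nobs T D)) in *.
  set (m := abs_mean D th) in *. rewrite <- ER in Hn.
  set (r := v / R0) in *.
  pose proof (log_ratio_expansion D th r) as HL.
  pose proof (hD_bounds D th Hlp) as Hhb.
  set (lam := th * D) in *.
  set (l := ln (1 + r)) in *.
  assert (Hr4 : Rabs r <= 1 / 4) by (pose proof (Rabs_pos r); nra).
  pose proof (ln_taylor1 r ltac:(lra)) as Hl1. pose proof (ln_taylor2 r ltac:(lra)) as Hl2.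
  fold l in Hl1, Hl2.
  set (i := / R0). assert (Hi : 0 < i <= 1).
  { split; [apply Rinv_0_lt_compat; lra|]. rewrite <- Rinv_1. apply Rinv_le_contravar; lra. }
  assert (Ei : R0 * i = 1) by (apply Rinv_r; lra).
  assert (Er : r = v * i) by reflexivity.
  assert (Er2 : r ^ 2 = V * i ^ 2) by (rewrite Er; unfold V; ring).
  assert (Era : Rabs r = Rabs v * i) by (rewrite Er, Rabs_mult, (Rabs_pos_eq i); lra).
  assert (ERr : R0 ^ 2 * r ^ 2 = V).
  { rewrite Er2. replace (R0 ^ 2 * (V * i ^ 2)) with ((R0 * i) ^ 2 * V) by ring. rewrite Ei. ring. }
  assert (Hr20 : 0 <= r ^ 2) by apply pow2_ge_0.
  assert (Hr2V : r ^ 2 <= V * i) by (rewrite Er2; apply Rmult_le_compat_l; nra).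
  set (w := n * lam * r ^ 2).
  assert (Hw : V - lam * V <= w <= V).
  { unfold w. split.
    - apply Rle_trans with ((R0 ^ 2 - lam) * r ^ 2); [|apply Rmult_le_compat_r; lra].
      assert (lam * r ^ 2 <= lam * V) by (apply Rmult_le_compat_l; nra). lra.
    - rewrite <- ERr. apply Rmult_le_compat_r; lra. }
  assert (Hw0 : 0 <= w) by (unfold w; apply Rmult_le_pos; nra).
  set (e := fun k => ln (fD D (th * (1 + r)) k / fD D th k)
        - (- (lam * r) + IZR (Z.abs k) * l + lam * r * hD D th k)).
  set (e0 := 2 * bessel_const * (lam * r) ^ 2) in *.
  assert (He : forall k, Rabs (e k) <= e0) by (intros k; apply HL; lra).
  destruct (is_mean_dominated (fD D th) e (fun _ => e0 * 1) (e0 * 1) Hp) as [Ee [HEe HEb]];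
    [intros k; rewrite Rmult_1_r; apply He|now apply is_mean_scal|]. rewrite Rmult_1_r in HEb.
  set (c := - (lam * r) + r * m + V / 2 / n).
  assert (Ege : forall k, g k = (l - r) * IZR (Z.abs k) + (e k + (lam * r * hD D th k + c))).
  { intros k. rewrite Eg. unfold e, c. ring. }
  set (a := (l - r) * m + (Ee + (lam * r * (1 - m / lam) + c * 1))).
  assert (Ha : is_mean (fD D th) g a).
  { eapply is_mean_ext; [intros k; symmetry; apply Ege|].
    apply is_mean_plus; [now apply is_mean_scal|].
    apply is_mean_plus; [exact HEe|].
    eapply is_mean_ext; [|apply is_mean_plus; apply is_mean_scal; [exact Hh|exact M0]].
    intros k. cbv beta. ring. }
  (* All terms linear in r disappear: - lam r from the exponential, r m from the centring, and lam r
     (1 - m / lam) from the mean of h add up to 0. *)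
  assert (Ena : n * a = n * m * (l - r) + n * Ee + V / 2).
  { unfold a, c. field. lra. }
  (* Bounds everything in g except (l - r) |k|: of the four units of lam |r|, two come from the
     Bessel remainder, one from h and one from r (m - lam). *)
  set (beta := 4 * lam * Rabs r + V / 2 / n).
  assert (Hn0 : 0 <= V / 2 / n) by (apply Rmult_le_pos; [lra|apply Rlt_le, Rinv_0_lt_compat; lra]).
  assert (Hlr : 0 <= lam * Rabs r) by (apply Rmult_le_pos; [lra|apply Rabs_pos]).
  assert (He0 : e0 <= 2 * lam * Rabs r).
  { unfold e0. rewrite <- (pow2_abs (lam * r)), Rabs_mult, (Rabs_pos_eq lam) by lra.
    replace (2 * bessel_const * (lam * Rabs r) ^ 2)
      with (2 * (lam * Rabs r) * (lam * (bessel_const * Rabs r))) by ring.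
    assert (0 <= bessel_const * Rabs r) by (apply Rmult_le_pos; [lra|apply Rabs_pos]).
    assert (lam * (bessel_const * Rabs r) <= 1) by nra. nra. }
  assert (HB : forall k, Rabs (e k + (lam * r * hD D th k + c)) <= beta).
  { intros k. specialize (He k). specialize (Hhb k). apply Rabs_le_between in He.
    set (h := hD D th k) in *.
    assert (K1 : Rabs (lam * r * h) <= lam * Rabs r).
    { rewrite !Rabs_mult, (Rabs_pos_eq lam), (Rabs_pos_eq h) by lra. nra. }
    assert (K2 : Rabs (r * (m - lam)) <= lam * Rabs r).
    { rewrite Rabs_mult, (Rabs_left1 (m - lam)) by lra. pose proof (Rabs_pos r). nra. }
    apply Rabs_le_between in K1, K2. unfold beta, c. apply Rabs_le.
    replace (- (lam * r) + r * m + V / 2 / n) with (r * (m - lam) + V / 2 / n) by ring. lra. }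
  destruct (is_mean_dominated (fD D th) (fun k => g k ^ 2)
    (fun k => 8 * (r ^ 2) ^ 2 * IZR k ^ 2 + 2 * beta ^ 2 * 1)
    (8 * (r ^ 2) ^ 2 * lam + 2 * beta ^ 2 * 1) Hp) as [b [Hb Hbb]].
  { intros k. rewrite Rabs_pos_eq by apply pow2_ge_0. rewrite Ege.
    specialize (HB k). set (B := e k + _) in *.
    assert (HB2 : B ^ 2 <= beta ^ 2).
    { rewrite <- (pow2_abs B). apply pow_incr. split; [apply Rabs_pos|exact HB]. }
    replace (IZR k ^ 2) with (IZR (Z.abs k) ^ 2) by (rewrite abs_IZR; apply pow2_abs).
    set (u := IZR (Z.abs k)).
    assert (Hl4 : (l - r) ^ 2 <= 4 * (r ^ 2) ^ 2).
    { rewrite <- (pow2_abs (l - r)). replace (4 * (r ^ 2) ^ 2) with ((2 * r ^ 2) ^ 2) by ring.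
      apply pow_incr. split; [apply Rabs_pos|exact Hl1]. }
    assert (((l - r) * u) ^ 2 <= 4 * (r ^ 2) ^ 2 * u ^ 2).
    { rewrite Rpow_mult_distr. apply Rmult_le_compat_r; [apply pow2_ge_0|exact Hl4]. }
    pose proof (pow2_ge_0 ((l - r) * u - B)). nra. }
  { apply is_mean_plus; now apply is_mean_scal. }
  exists a, b. split; [exact Ha|]. split; [exact Hb|].
  pose proof (Rabs_pos r) as Hra.
  assert (HnE : Rabs (n * Ee) <= 2 * bessel_const * V * lam).
  { rewrite Rabs_mult, (Rabs_pos_eq n) by lra.
    apply Rle_trans with (n * e0); [apply Rmult_le_compat_l; lra|].
    replace (n * e0) with (2 * bessel_const * lam * w) by (unfold e0, w; ring).
    assert (0 <= bessel_const * lam) by nra. nra. }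
  fold i. split.
  - set (t := l - r + r ^ 2 / 2) in *.
    assert (Hnmt : Rabs (n * m * t) <= 2 * V * Rabs r).
    { rewrite Rabs_mult, (Rabs_pos_eq (n * m)) by (apply Rmult_le_pos; lra).
      apply Rle_trans with (n * lam * (2 * Rabs r ^ 3)).
      - apply Rmult_le_compat; [apply Rmult_le_pos; lra|apply Rabs_pos| |exact Hl2].
        apply Rmult_le_compat_l; lra.
      - replace (Rabs r ^ 3) with (r ^ 2 * Rabs r) by (rewrite <- (pow2_abs r); ring).
        replace (n * lam * (2 * (r ^ 2 * Rabs r))) with (2 * w * Rabs r) by (unfold w; ring). nra. }
    assert (Hnm : V - 2 * (lam * V) <= n * m * r ^ 2 <= V).
    { assert (n * m * r ^ 2 <= w).
      { unfold w. apply Rmult_le_compat_r; [exact Hr20|]. apply Rmult_le_compat_l; lra. }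
      assert (w - lam * w <= n * m * r ^ 2).
      { unfold w. replace (n * lam * r ^ 2 - lam * (n * lam * r ^ 2))
          with (n * (lam - lam ^ 2) * r ^ 2) by ring.
        apply Rmult_le_compat_r; [exact Hr20|]. apply Rmult_le_compat_l; lra. }
      assert (lam * w <= lam * V) by (apply Rmult_le_compat_l; lra). lra. }
    assert (Ena2 : n * a = n * m * t - n * m * r ^ 2 / 2 + n * Ee + V / 2)
      by (rewrite Ena; unfold t; field).
    rewrite Ena2. rewrite Era in Hnmt.
    apply Rabs_le_between in Hnmt, HnE.
    assert (0 <= lam * V) by (apply Rmult_le_pos; lra).
    assert (0 <= V * Rabs v * lam) by (apply Rmult_le_pos; lra).
    assert (0 <= V * i) by (apply Rmult_le_pos; lra).
    assert (0 <= bessel_const * V * i) by (apply Rmult_le_pos; lra).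
    assert (0 <= (10 * V ^ 2 + 64 * V) * (lam + i)) by (apply Rmult_le_pos; lra).
    apply Rabs_le. lra.
  - apply Rabs_le_between in Hbb.
    (* From n lam >= th T - lam >= 3 / 4. *)
    assert (Hni : / n <= 2 * lam).
    { apply Rmult_le_reg_l with n; [lra|]. rewrite Rinv_r by lra.
      assert (1 <= R0 ^ 2) by (rewrite <- (pow1 2); apply pow_incr; lra). nra. }
    assert (Hbeta : n * beta ^ 2 <= 32 * lam * V + V ^ 2 * lam).
    { apply Rle_trans with (32 * (lam * w) + V ^ 2 / 2 * / n).
      - unfold beta, w. rewrite <- (pow2_abs r).
        replace (32 * (lam * (n * lam * Rabs r ^ 2)) + V ^ 2 / 2 * / n)
          with (n * (2 * (4 * lam * Rabs r) ^ 2 + 2 * (V / 2 / n) ^ 2)) by (field; lra).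
        apply Rmult_le_compat_l; [lra|].
        pose proof (pow2_ge_0 (4 * lam * Rabs r - V / 2 / n)). nra.
      - assert (lam * w <= lam * V) by (apply Rmult_le_compat_l; lra).
        assert (V ^ 2 / 2 * / n <= V ^ 2 / 2 * (2 * lam)) by (apply Rmult_le_compat_l; lra). lra. }
    apply Rle_trans with (8 * (w * r ^ 2) + 2 * (n * beta ^ 2)).
    + replace (8 * (w * r ^ 2) + 2 * (n * beta ^ 2))
        with (n * (8 * (r ^ 2) ^ 2 * lam + 2 * beta ^ 2 * 1)) by (unfold w; ring).
      apply Rmult_le_compat_l; lra.
    + assert (w * r ^ 2 <= V * (V * i)) by (apply Rmult_le_compat; lra).
      assert (0 <= (2 * V * Rabs v + V + 2 * bessel_const * V) * (lam + i))
        by (apply Rmult_le_pos; lra).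
      assert (0 <= V ^ 2 * lam) by (apply Rmult_le_pos; lra).
      assert (0 <= V ^ 2 * i) by (apply Rmult_le_pos; lra).
      assert (0 <= V * i) by (apply Rmult_le_pos; lra). lra.
Qed.

(** Chebyshev's bound is M kap + (M kap)^2 over eps^2, where kap is the sum of the two small
    quantities; kap <= 2 makes it linear in kap. *)
Lemma lan_remainder_prob (v eps : R) : 0 < eps ->
  exists M, 0 <= M /\ forall D th T (A : list Z -> Prop),
    0 < th -> 0 < D <= T -> 1 <= sqrt (th * T) -> th * D <= 1 / 4 ->
    bessel_const * Rabs (v / sqrt (th * T)) <= 1 ->
    (forall y, length y = nobs T D -> A y ->
       eps < Rabs (sum_list (lan_remainder D th T v) y)) ->
    prob_iid (fD D th) (nobs T D) A <= M * (th * D + / sqrt (th * T)).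
Proof.
  intros Heps. destruct (lan_remainder_moments v) as [M [HM H]].
  exists ((M + 2 * M ^ 2) / eps ^ 2).
  assert (E2 : 0 < eps ^ 2) by now apply pow_lt.
  pose proof (pow2_ge_0 M).
  split; [apply Rmult_le_pos; [lra|apply Rlt_le, Rinv_0_lt_compat, E2]|].
  intros D th T A Hth HD HR Hlam Hr HA.
  destruct (H D th T Hth HD HR Hlam Hr) as [a [b [Ha [Hb [Hna Hnb]]]]].
  assert (Hlp : 0 < th * D) by nra.
  eapply Rle_trans.
  { apply (chebyshev (fD D th) (fD_nonneg D th Hlp) (fD_mass D th Hlp) _ _ _ _ _ _ Heps HA Ha Hb). }
  set (kap := th * D + / sqrt (th * T)) in *.
  assert (Hk : 0 <= kap <= 2).
  { unfold kap. assert (0 < / sqrt (th * T)) by (apply Rinv_0_lt_compat; lra).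
    assert (/ sqrt (th * T) <= 1) by (rewrite <- Rinv_1; apply Rinv_le_contravar; lra). lra. }
  replace ((M + 2 * M ^ 2) / eps ^ 2 * kap) with ((M + 2 * M ^ 2) * kap / eps ^ 2)
    by (unfold Rdiv; ring).
  apply Rmult_le_compat_r; [apply Rlt_le, Rinv_0_lt_compat, E2|].
  replace (INR (nobs T D) ^ 2 * a ^ 2) with (Rabs (INR (nobs T D) * a) ^ 2)
    by (rewrite pow2_abs; ring).
  assert (Rabs (INR (nobs T D) * a) ^ 2 <= (M * kap) ^ 2)
    by (apply pow_incr; split; [apply Rabs_pos|exact Hna]).
  assert (M ^ 2 * (kap * kap) <= M ^ 2 * (2 * kap)) by (apply Rmult_le_compat_l; nra).
  replace ((M * kap) ^ 2) with (M ^ 2 * (kap * kap)) in * by ring. lra.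
Qed.

(** * Passage to the limit and the LAN property *)

Lemma eventually_small (Delta : R -> R) (th kap : R) :
  (forall T, 0 < T -> 0 < Delta T <= T) ->
  (forall e, 0 < e -> exists T0, forall T, T0 <= T -> Rabs (Delta T) < e) ->
  0 < th -> 0 < kap ->
  exists T0, forall T, T0 <= T -> 0 < T ->
    th * Delta T <= kap /\ / kap <= sqrt (th * T).
Proof.
  intros HD H0 Hth Hk. destruct (H0 (kap / th)) as [T1 H1].
  { now apply Rdiv_lt_0_compat. }
  exists (Rmax T1 ((/ kap) ^ 2 / th)). intros T HT HTp. split.
  - specialize (H1 T (Rle_trans _ _ _ (Rmax_l _ _) HT)). specialize (HD T HTp).
    rewrite Rabs_pos_eq in H1 by lra. apply Rlt_div_r in H1; lra.
  - assert (Hk2 : 0 < / kap) by now apply Rinv_0_lt_compat.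
    rewrite <- (sqrt_pow2 (/ kap)) by lra. apply sqrt_le_1_alt.
    assert (HT2 : (/ kap) ^ 2 / th <= T) by (eapply Rle_trans; [apply Rmax_r|exact HT]).
    apply Rle_div_l in HT2; lra.
Qed.

Theorem theorem2 (Theta : R -> Prop) (Delta : R -> R)
  (HTheta : forall x, Theta x ->
      0 < x /\ exists e, 0 < e /\ forall y, Rabs (y - x) < e -> Theta y)
  (HDpos : forall T, 0 < T -> 0 < Delta T <= T)
  (HD0 : forall e, 0 < e -> exists T0, forall T, T0 <= T -> Rabs (Delta T) < e) :
  forall th, Theta th ->
    LAN Theta Delta th (fun T => T / th) /\
    (forall T, 0 < T -> forall e, 0 < e -> exists d, 0 < d /\
       forall D, 0 < D < d -> Rabs (T * D * phiD th D - T / th) < e).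
Proof.
  intros th Hin. destruct (HTheta th Hin) as [Hth _]. split.
  2: { intros T HT e He. exists (Rmin (/ th) (e / (3 * T))). split.
       (* The first entry of the minimum ensures th D <= 1, the second makes the error 3 T D smaller
          than e. *)
       - apply Rmin_pos; [now apply Rinv_0_lt_compat|]. apply Rdiv_lt_0_compat; lra.
       - intros D [HD1 HD2].
         assert (D1 : D < / th) by (eapply Rlt_le_trans; [exact HD2|apply Rmin_l]).
         assert (D2 : D < e / (3 * T)) by (eapply Rlt_le_trans; [exact HD2|apply Rmin_r]).
         eapply Rle_lt_trans; [apply information_limit; try assumption|].
         + rewrite <- (Rinv_r th) by lra. apply Rmult_le_compat_l; lra.
         + apply Rlt_div_r in D2; lra. }
  split; [intros T HT; now apply Rdiv_lt_0_compat|].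
  exists (fun T => path_sum (std_abs (Delta T) th T)). split.
  - intros x eps Heps.
    pose proof (Rabs_pos x) as Hx.
    (* Smoothing takes half of eps. The 7 in place of 6, and the 1 added in B below, leave room for
       a strict inequality. *)
    set (del := Rmin (1 / 2) (eps / 2 / (7 + 2 * Rabs x))).
    assert (Hq : 0 < eps / 2 / (7 + 2 * Rabs x)) by (apply Rdiv_lt_0_compat; lra).
    assert (Hdel : 0 < del <= 1 / 2) by (split; [apply Rmin_pos; lra|apply Rmin_l]).
    assert (Hdel2 : (7 + 2 * Rabs x) * del <= eps / 2).
    { assert (D2 : del <= eps / 2 / (7 + 2 * Rabs x)) by apply Rmin_r.
      apply Rle_div_r in D2; lra. }
    destruct (std_abs_normal_approx x del Hdel) as [C [HC H]].
    set (B := 2 * Rabs x + C + 1).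
    set (kap := Rmin (1 / 4) (eps / 4 / B)).
    assert (HB : 0 < eps / 4 / B) by (apply Rdiv_lt_0_compat; unfold B; lra).
    assert (Hk : 0 < kap) by (apply Rmin_pos; lra).
    assert (Hk1 : kap <= 1 / 4) by apply Rmin_l.
    assert (Hk2 : B * kap <= eps / 4).
    { assert (D2 : kap <= eps / 4 / B) by apply Rmin_r.
      apply Rle_div_r in D2; unfold B in *; lra. }
    destruct (eventually_small Delta th kap HDpos HD0 Hth Hk) as [T0 HT0].
    exists T0. intros T HT HTp. destruct (HT0 T HT HTp) as [S1 S2].
    assert (Hik : 1 <= / kap) by (rewrite <- Rinv_1; apply Rinv_le_contravar; lra).
    assert (S3 : / sqrt (th * T) <= kap).
    { rewrite <- (Rinv_inv kap). apply Rinv_le_contravar; lra. }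
    unfold prob_obs. eapply Rle_lt_trans.
    { apply (H th (Delta T) T); [exact Hth|now apply HDpos|lra|lra|].
      intros l _. unfold path_of. rewrite path_sum_psums. reflexivity. }
    assert ((2 * Rabs x + C) * (th * Delta T + / sqrt (th * T)) <= B * (kap + kap)).
    { assert (0 < / sqrt (th * T)) by (apply Rinv_0_lt_compat; lra).
      pose proof (HDpos T HTp). assert (0 < th * Delta T) by nra.
      apply Rmult_le_compat; unfold B; lra. }
    lra.
  - intros v eps del Heps Hdel.
    destruct (lan_remainder_prob v eps Heps) as [M [HM H]].
    pose proof bessel_const_ge as HC. pose proof (Rabs_pos v) as Hv.
    (* With kap <= 1 / W both [bessel_const * Rabs v * kap <= 1] and, because W >= 4, kap <= 1 / 4
       hold. *)
    set (W := bessel_const * (1 + Rabs v)). assert (HW : 4 <= W) by (unfold W; nra).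
    set (kap := Rmin (/ W) (del / 4 / (M + 1))).
    assert (HW2 : 0 < / W) by (apply Rinv_0_lt_compat; lra).
    assert (HB : 0 < del / 4 / (M + 1)) by (apply Rdiv_lt_0_compat; lra).
    assert (Hk : 0 < kap) by (apply Rmin_pos; lra).
    assert (Hk1 : W * kap <= 1).
    { rewrite <- (Rinv_r W) by lra. apply Rmult_le_compat_l; [lra|apply Rmin_l]. }
    assert (Hk3 : (M + 1) * kap <= del / 4).
    { assert (D2 : kap <= del / 4 / (M + 1)) by apply Rmin_r. apply Rle_div_r in D2; lra. }
    assert (Hk2 : kap <= 1 / 4) by nra.
    destruct (eventually_small Delta th kap HDpos HD0 Hth Hk) as [T0 HT0].
    exists T0. intros T HT HTp _. destruct (HT0 T HT HTp) as [S1 S2].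
    assert (Hik : 1 <= / kap) by (rewrite <- Rinv_1; apply Rinv_le_contravar; lra).
    assert (S3 : / sqrt (th * T) <= kap).
    { rewrite <- (Rinv_inv kap). apply Rinv_le_contravar; lra. }
    assert (S4 : 0 < / sqrt (th * T)) by (apply Rinv_0_lt_compat; lra).
    pose proof (HDpos T HTp) as HDT. assert (Hlp : 0 < th * Delta T) by nra.
    assert (Hr : bessel_const * Rabs (v / sqrt (th * T)) <= 1).
    { unfold Rdiv. rewrite Rabs_mult, (Rabs_pos_eq (/ _)) by lra.
      apply Rle_trans with (W * kap); [|exact Hk1]. unfold W. rewrite Rmult_assoc.
      apply Rmult_le_compat_l; [lra|]. apply Rmult_le_compat; lra. }
    assert (Eth : th + v / sqrt (T / th) = th * (1 + v / sqrt (th * T))).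
    { replace (th * T) with (th ^ 2 * (T / th)) by (field; lra).
      rewrite sqrt_mult_alt, sqrt_pow2 by (try apply pow2_ge_0; lra).
      assert (0 < sqrt (T / th)) by (apply sqrt_lt_R0, Rdiv_lt_0_compat; lra).
      field. lra. }
    rewrite Eth.
    (* Keeps th (1 + r) positive, so that the shifted increment law has positive weights and the
       logarithm of the likelihood ratio splits into a sum. *)
    assert (Hr2 : Rabs (v / sqrt (th * T)) <= 1 / 4)
      by (pose proof (Rabs_pos (v / sqrt (th * T))); nra).
    apply Rabs_le_between in Hr2.
    unfold prob_obs. eapply Rle_lt_trans.
    { apply (H (Delta T) th T); [exact Hth|exact HDT|lra|lra|exact Hr|].
      intros y Hy. unfold path_of. rewrite path_sum_psums, ln_lr_path_psums.
      - intros Hgt. unfold lan_remainder. rewrite sum_list_affine, Hy.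
        destruct (nobs_bounds th T (Delta T) Hth HDT) as [Hn1 _].
        match goal with |- eps < Rabs ?z => match type of Hgt with eps < Rabs ?u =>
          replace z with u by (field; lra) end end.
        exact Hgt.
      - intros k. apply fD_pos. apply Rmult_lt_0_compat; [|lra]. apply Rmult_lt_0_compat; lra.
      - intros k. now apply fD_pos. }
    assert (M * (th * Delta T + / sqrt (th * T)) <= (M + 1) * (kap + kap))
      by (apply Rmult_le_compat; lra).
    lra.
Qed.
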